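(* Let $X$ be an infinite-dimensional separable real Banach space and let $|\cdot|$ be the equivalent norm on $X$ constructed in the context. Then the following conditions hold: (i) $(X,|\cdot|)$ is G\^ateaux smooth; (ii) $(X,|\cdot|)$ is average locally uniformly rotund (ALUR); (iii) if $X$ is reflexive, then $(X^*,|\cdot|^* )$ is Fr\'echet smooth, where $|\cdot|^*$ is the dual norm of $|\cdot|$; (iv) $(X,|\cdot|)$ is not locally uniformly rotund (LUR).
   Context: Rotundity and smoothness. For a Banach space $(Z,\|\cdot\|)$, $B_Z$, $U_Z$, $S_Z$ denote the closed unit ball, open unit ball and unit sphere (written $B_{(Z,\|\cdot\|)}$ etc. when the norm must be specified). A slice of $K\subset Z$ is a set $\{y\in K: z^*(y)>\sup z^*(K)-\alpha\}$ with $\alpha>0$ and $z^*\in Z^*\setminus\{0\}$ bounded above on $K$. A point $x\in S_Z$ is a denting point of $B_Z$ if for each norm neighbourhood $V$ of $x$ there is a slice $S$ of $B_Z$ with $x\in S\subset V$. $Z$ (or its norm) is ALUR if every point of $S_Z$ is a denting point of $B_Z$. It is LUR if for every $x\in S_Z$ one has $x_n\to x$ in norm whenever $(x_n)_n\subset Z$ satisfies $\lim_n(2\|x\|^2+2\|x_n\|^2-\|x+x_n\|^2)=0$. It is G\^ateaux smooth (respectively Fr\'echet smooth) if for every $x\in S_Z$, $\lim_{h\to0}\frac{\|x+hy\|+\|x-hy\|-2}{h}=0$ for every $y\in S_Z$ (respectively uniformly for $y\in S_Z$). Construction. $X$ is an infinite-dimensional separable real Banach space. An M-basis is a biorthogonal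 system $(e_n,g_n)_{n\in\mathbb N}\subset X\times X^*$ (i.e. $g_m(e_n)=\delta_{m,n}$) such that $\mathrm{span}\{e_n\}$ is dense in $X$ and $\mathrm{span}\{g_n\}$ is $w^*$-dense in $X^*$. Fix an equivalent norm $|\!|\!|\cdot|\!|\!|$ on $X$ and an M-basis $(e_n,g_n)_{n\in\mathbb N}$ on $X$ (these exist) such that: (1) $|\!|\!|\cdot|\!|\!|$ is LUR and G\^ateaux smooth; (2) $|\!|\!|x|\!|\!|^2=|\!|\!|x-g_1(x)e_1|\!|\!|^2+[g_1(x)]^2$ for all $x\in X$; (3) $|\!|\!|e_n|\!|\!|=1$ for all $n\in\mathbb N$; (4) $|\!|\!|g_1|\!|\!|^*=|\!|\!|g_{3n}|\!|\!|^*=1$ for all $n\in\mathbb N$. Define $T:\ell_2\to X$ by $T\alpha=\sqrt2\,\alpha_1e_1+\sum_{n=2}^\infty\frac1{n^2}\alpha_ne_n$ for $\alpha=(\alpha_n)_n\in\ell_2$, and put $B=T[B_{\ell_2}]$, a compact convex subset of $X$. Let $D=\mathrm{conv}\bigl(B_{(X,|\!|\!|\cdot|\!|\!|)}\cup B\bigr)$, which is the closed unit ball of an equivalent norm $\|\cdot\|$ on $X$. Let $f_n=g_n/|\!|\!|g_n|\!|\!|^*$ for $n\in\mathbb N$, and define the equivalent norm $|\cdot|$ on $X$ by $|x|^2=\|x\|^2+\sum_{n=2}^\infty 2^{-n}f_n(x)^2$. *)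

(* Defs.v *)
From HB Require Import structures.
From mathcomp Require Import all_boot all_order all_algebra.
From mathcomp Require Import all_classical all_reals all_analysis.

Set Implicit Arguments.
Unset Strict Implicit.
Unset Printing Implicit Defensive.

Import Order.TTheory GRing.Theory Num.Theory.
Import numFieldNormedType.Exports.

Local Open Scope classical_set_scope.
Local Open Scope ring_scope.

(* Several norms live on one vector space, so a normed space (Z, N) is given by
   an lmodType Z together with an explicit function N : Z -> R, and every notion
   below takes N as a parameter. *)

Section norms.
Context {R : realType}.

Definition is_norm (Z : lmodType R) (N : Z -> R) : Prop :=
  [/\ forall x y, N (x + y) <= N x + N y,
      forall (a : R) x, N (a *: x) = `|a| * N x
    & forall x, N x = 0 -> x = 0].

Definition equivalent_norm (X : normedModType R) (N : X -> R) : Prop :=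
  is_norm N /\
  exists c C : R, [/\ 0 < c, 0 < C & forall x, c * `|x| <= N x <= C * `|x|].

Definition closed_unit_ball (Z : Type) (N : Z -> R) : set Z :=
  [set x | N x <= 1].

End norms.

Section dual.
Context {R : realType} (Z : lmodType R) (N : Z -> R).

Definition bounded_functional : {pred Z -> R^o} :=
  [pred f | `[< linear f /\ exists M : R, forall x, `|f x| <= M * N x >]].

Lemma bounded_functional_submod_closed : submod_closed bounded_functional.
Proof.
split=> [|a f g /asboolP[fl [M fM]] /asboolP[gl [K gK]]]; apply/asboolP; split.
- by move=> a x y /=; rewrite scaler0 addr0.
- by exists 0 => x /=; rewrite normr0 mul0r.
- move=> b x y; rewrite -![(_ + g) _]/(_ + g _) -![(a *: f) _]/(a *: f _).
  by rewrite fl gl !scalerDr !scalerA addrACA mulrC.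
- exists (`|a| * M + K) => x; rewrite mulrDl -mulrA.
  rewrite (le_trans (ler_normD _ _))// lerD// normrM.
  by rewrite ler_wpM2l.
Qed.

HB.instance Definition _ := GRing.isSubmodClosed.Build R (Z -> R^o)
  bounded_functional bounded_functional_submod_closed.

(* The topological dual of (Z, N); boundedness is relative to N. *)
Record dual := Dual {
  dual_fun :> Z -> R^o ;
  dual_funP : dual_fun \in bounded_functional }.

HB.instance Definition _ := [isSub for dual_fun].
HB.instance Definition _ := [Choice of dual by <:].
HB.instance Definition _ := [SubChoice_isSubLmodule of dual by <:].

Definition dual_norm (f : Z -> R) : R :=
  sup [set `|f x| | x in closed_unit_ball N].

(* The w*-topology is the trace of pointwise convergence on the dual. *)
Definition weak_star_dense (A : set dual) : Prop :=
  dense (A : set (initial_topology (fun f : dual => (f : {ptws Z -> R})))).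

End dual.

Section rotundity_smoothness.
Context {R : realType} (Z : lmodType R) (N : Z -> R).

Definition slice_of (K S : set Z) : Prop :=
  exists (f : dual N) (alpha : R),
    [/\ f <> 0, has_ubound (f @` K), 0 < alpha
      & S = [set y | K y /\ f y > sup (f @` K) - alpha]].

Definition norm_nbhs (x : Z) (V : set Z) : Prop :=
  exists2 r : R, 0 < r & [set y | N (y - x) < r] `<=` V.

Definition denting_point (K : set Z) (x : Z) : Prop :=
  forall V, norm_nbhs x V -> exists S, [/\ slice_of K S, S x & S `<=` V].

Definition ALUR : Prop :=
  forall x, N x = 1 -> denting_point (closed_unit_ball N) x.

Definition LUR : Prop :=
  forall x, N x = 1 -> forall u : nat -> Z,
    (2 * N x ^+ 2 + 2 * N (u n) ^+ 2 - N (x + u n) ^+ 2) @[n --> \oo] --> 0 ->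
    N (u n - x) @[n --> \oo] --> 0.

Definition gateaux_smooth : Prop :=
  forall x, N x = 1 -> forall y, N y = 1 ->
    ((N (x + h *: y) + N (x - h *: y) - 2) / h) @[h --> 0^'] --> 0.

Definition frechet_smooth : Prop :=
  forall x, N x = 1 -> forall eps : R, 0 < eps ->
    \forall h \near 0^', forall y, N y = 1 ->
      `|(N (x + h *: y) + N (x - h *: y) - 2) / h| < eps.

(* The canonical embedding into the bidual is onto. *)
Definition reflexive_space : Prop :=
  forall phi : dual (dual_norm N : dual N -> R),
    exists z : Z, forall f : dual N, phi f = f z.

End rotundity_smoothness.

(* Sequences indexed by {1, 2, 3, ...} are functions on nat whose value at 0 is
   never used. *)

Section construction.
Context {R : realType}.

Definition lin_span (Z : lmodType R) (u : nat -> Z) : set Z :=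
  [set x | exists (n : nat) (a : nat -> R), x = \sum_(1 <= k < n) a k *: u k].

Definition infinite_dimensional (Z : lmodType R) : Prop :=
  ~ exists (n : nat) (v : 'I_n -> Z),
      forall x, exists a : 'I_n -> R, x = \sum_(i < n) a i *: v i.

Definition separable (T : topologicalType) : Prop :=
  exists2 S : set T, countable S & dense S.

Variable X : completeNormedModType R.

Definition M_basis (e : nat -> X) (g : nat -> dual (@Num.norm R X)) : Prop :=
  [/\ forall m n, (0 < m)%N -> (0 < n)%N -> g m (e n) = (m == n)%:R,
      dense (lin_span e)
    & weak_star_dense (lin_span g)].

Definition l2_ball : set (nat -> R) :=
  [set a | cvgn (fun n => (\sum_(1 <= k < n) a k ^+ 2 : R)) /\
           Num.sqrt (\big[+%R/0]_(1 <= k <oo) a k ^+ 2) <= 1].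

Definition T_op (e : nat -> X) (a : nat -> R) : X :=
  (Num.sqrt 2 * a 1%N) *: e 1%N +
  \big[+%R/0]_(2 <= n <oo) (((n%:R ^+ 2)^-1 * a n) *: e n).

Definition convex_hull (Z : lmodType R) (A : set Z) : set Z :=
  smallest (@convex_set R Z) A.

Definition D_set (trinorm : X -> R) (e : nat -> X) : set X :=
  convex_hull (closed_unit_ball trinorm `|` T_op e @` l2_ball).

(* D is convex, closed, bounded, symmetric and a neighborhood of 0, so the norm
   whose closed unit ball is D is its Minkowski gauge. *)
Definition gauge_of (Z : lmodType R) (K : set Z) (x : Z) : R :=
  inf [set t : R | 0 < t /\ K (t^-1 *: x)].

Definition norm_D (trinorm : X -> R) (e : nat -> X) : X -> R :=
  gauge_of (D_set trinorm e).

Definition constructed_norm (trinorm : X -> R) (e : nat -> X)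
    (g : nat -> dual (@Num.norm R X)) (x : X) : R :=
  Num.sqrt (norm_D trinorm e x ^+ 2 +
    \big[+%R/0]_(2 <= n <oo) (2 ^- n * (g n x / dual_norm trinorm (g n)) ^+ 2)).

End construction.

(* Main.v *)
(** Write [T] for the given norm, [p] for the gauge of [D], [N] for the
    constructed norm, and [N^2 = p^2 + Q] with [Q] a quadratic form.  By
    compactness of [B], every [x] splits as [u + T_op a] with
    [T u + |a|_2 <= p x].  If [u <> 0] the smoothness of [T] at [u] passes to
    [p] at [x]; if [u = 0] that of the l2-norm does.  Hence [p] and [N] are
    Gateaux smooth, and this already provides support functionals, so neither
    Hahn-Banach nor a separation theorem is needed.

    Let [N x = 1], [psi] support [p] at [x], and [phi] be half the derivative of
    [N^2] at [x].  If [phi y] is close to 1 and [N y <= 1], then [p y], [psi y]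
    and all [f_n y] are close to their values at [x].  Split [y = u + T_op a].
    Since l2 is uniformly convex, [T_op a] is close to a multiple of
    [b0 = T_op c], where [c] represents [psi \o T_op].  If the splitting of
    [x] has a nonzero [T]-part [u0], LUR of [T] makes [u] close to a multiple of
    [u0], and [psi] and the [f_n] fix the two coefficients, so that [phi]
    strongly exposes [x].  Otherwise [x] is a multiple of [b0].  If [T b0 <= 1]
    this is the previous case; if [T b0 > 1], a support functional [th] of [T]
    at [b0] decreases by a fixed amount whenever the [T]-part of [y] is not
    small, and [th + C phi] cuts out a small slice containing [x].

    ALUR norms are rotund, and in a reflexive space weak limits along an
    ultrafilter turn this into strong exposure by every norm-one functional,
    which is Frechet smoothness of the dual norm.  Finally
    [x = sqrt 2 e_1] and [u_n = (e_1 + e_{3n}) / sqrt 2] refute LUR: the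
    functional [(g_1 + g_{3n}) / sqrt 2] is almost bounded by 1 on [D] and takes
    the value 1 at both points. *)

Require Import Defs.
From mathcomp Require Import all_boot all_order all_algebra.
From mathcomp Require Import all_classical all_reals all_analysis.
From mathcomp Require Import ring lra.

Set Implicit Arguments.
Unset Strict Implicit.
Unset Printing Implicit Defensive.

Import Order.TTheory GRing.Theory Num.Theory.
Import numFieldNormedType.Exports.
Local Open Scope classical_set_scope.
Local Open Scope ring_scope.

(** * Norms, smoothness and support functionals *)

Section norm_theory.
Context {R : realType} {Z : lmodType R} {N : Z -> R}.
Hypothesis N_norm : is_norm N.

Lemma is_normD x y : N (x + y) <= N x + N y.
Proof. by case: N_norm. Qed.

Lemma is_normZ (a : R) x : N (a *: x) = `|a| * N x.
Proof. by case: N_norm. Qed.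

Lemma is_norm_eq0 x : N x = 0 -> x = 0.
Proof. by case: N_norm => _ _; apply. Qed.

Lemma is_norm0 : N 0 = 0.
Proof. by rewrite -(scale0r (0 : Z)) is_normZ normr0 mul0r. Qed.

Lemma is_normN x : N (- x) = N x.
Proof. by rewrite -scaleN1r is_normZ normrN normr1 mul1r. Qed.

Lemma is_norm_ge0 x : 0 <= N x.
Proof.
have := is_normD x (- x); rewrite subrr is_norm0 is_normN; lra.
Qed.

Lemma is_norm_gt0 x : x <> 0 -> 0 < N x.
Proof.
move=> x0; rewrite lt_neqAle is_norm_ge0 andbT eq_sym; apply/eqP => /is_norm_eq0.
exact: x0.
Qed.

Lemma is_norm_distC x y : N (x - y) = N (y - x).
Proof. by rewrite -is_normN opprB. Qed.

Lemma is_normB x y : N (x - y) <= N x + N y.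
Proof. by rewrite -(is_normN y) is_normD. Qed.

Lemma is_norm_split x y : N x <= N y + N (x - y).
Proof. by have := is_normD y (x - y); rewrite addrC subrK. Qed.

Lemma is_norm_unit x : x <> 0 -> N ((N x)^-1 *: x) = 1.
Proof.
move=> /is_norm_gt0 x0.
by rewrite is_normZ ger0_norm ?invr_ge0 ?ltW// mulVf ?gt_eqF.
Qed.

End norm_theory.

Section functionals.
Context {R : realType} {Z : lmodType R}.

(** Kept as a predicate on bare functions, so that directional derivatives, limits and elements of
    different [dual] types are handled alike; [dual_lin] and [lin_dual] convert. *)
Definition lin (f : Z -> R) := forall (a : R) x y, f (a *: x + y) = a * f x + f y.

Section lin_theory.
Context {f : Z -> R}.
Hypothesis fl : lin f.

Lemma lin0 : f 0 = 0.
Proof. by have := fl (-1) 0 0; rewrite scaler0 addr0; lra. Qed.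

Lemma linZ a x : f (a *: x) = a * f x.
Proof. by rewrite -[a *: x]addr0 fl lin0 addr0. Qed.

Lemma linD x y : f (x + y) = f x + f y.
Proof. by rewrite -[x in LHS]scale1r fl mul1r. Qed.

Lemma linN x : f (- x) = - f x.
Proof. by rewrite -scaleN1r linZ mulN1r. Qed.

Lemma linB x y : f (x - y) = f x - f y.
Proof. by rewrite linD linN. Qed.

Lemma lin_sum (I : Type) (s : seq I) (P : pred I) (F : I -> Z) :
  f (\sum_(i <- s | P i) F i) = \sum_(i <- s | P i) f (F i).
Proof.
by elim/big_ind2 : _ => //; [exact: lin0|move=> x a y b <- <-; rewrite linD].
Qed.

Lemma lin_le_normr (N : Z -> R) : is_norm N -> (forall x, f x <= N x) ->
  forall x, `|f x| <= N x.
Proof.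
move=> Nn fN x; rewrite ler_norml fN andbT.
by have := fN (- x); rewrite linN (is_normN Nn) lerNl.
Qed.

End lin_theory.

Lemma lin_comb (a b : R) (f g : Z -> R) : lin f -> lin g ->
  lin (fun x => a * f x + b * g x).
Proof. by move=> fl gl c x y; rewrite fl gl; ring. Qed.

(** Gateaux smoothness in homogeneous form, at points of any norm. No absolute value appears on the
    left because second differences of a norm are nonnegative ([second_difference_ge0]). *)
Definition smooth_at (N : Z -> R) (x : Z) := forall y (eps : R), 0 < eps ->
  exists2 d : R, 0 < d & forall h : R, `|h| < d ->
    N (x + h *: y) + N (x - h *: y) - 2 * N x <= eps * `|h|.

Context {N : Z -> R}.
Hypothesis N_norm : is_norm N.
Let N0 := is_norm0 N_norm.
Let NZ := is_normZ N_norm.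
Let ND := is_normD N_norm.
Let N_ge0 := is_norm_ge0 N_norm.

Lemma second_difference_ge0 x y : 0 <= N (x + y) + N (x - y) - 2 * N x.
Proof.
have := ND (x + y) (x - y).
rewrite addrACA subrr addr0 -mulr2n -scaler_nat NZ ger0_norm//; lra.
Qed.

Lemma gateaux_smooth_at x : gateaux_smooth N -> x <> 0 -> smooth_at N x.
Proof.
move=> Ng x0 y eps e0; have Nx := is_norm_gt0 N_norm x0.
have [->|/eqP y0] := eqVneq y 0.
  exists 1 => // h _; rewrite scaler0 subr0 addr0.
  by apply: (@le_trans _ _ 0); [lra|rewrite mulr_ge0// ltW].
have Ny := is_norm_gt0 N_norm y0.
have /cvgrPdist_lt /(_ (eps / N y)) := Ng _ (is_norm_unit N_norm x0) _
  (is_norm_unit N_norm y0).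
rewrite divr_gt0// => /(_ isT) [d /= d0 H].
exists (d * N x / N y); first by rewrite divr_gt0// mulr_gt0.
move=> h hd.
have [->|h0] := eqVneq h 0.
  by rewrite !scale0r addr0 subr0 normr0 mulr0; lra.
(* Normalizing [x] and [y] turns the step [h] into [k] and divides the second difference by
   [N x]. *)
pose k := h * N y / N x.
have k0 : k != 0 by rewrite /k !mulf_neq0// ?invr_neq0// gt_eqF.
have nk : `|k| = `|h| * N y / N x.
  by rewrite /k !normrM normfV (ger0_norm (ltW Nx)) (ger0_norm (ltW Ny)).
have /(H k) : ball_ Num.norm 0 d k.
  by rewrite /= sub0r normrN nk ltr_pdivrMr// -ltr_pdivlMr.
move=> /(_ k0); rewrite sub0r normrN.
have -> : k *: ((N y)^-1 *: y) = (N x)^-1 *: (h *: y).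
  rewrite !scalerA; congr (_ *: _); rewrite /k; field.
  by rewrite !gt_eqF.
rewrite normrM normfV nk -scalerDr -scalerBr !NZ.
have /ger0_norm -> : 0 <= (N x)^-1 by rewrite invr_ge0 ltW.
rewrite ltr_pdivrMr; last by rewrite divr_gt0 ?mulr_gt0 ?normr_gt0.
move=> /ltW/(le_trans (ler_norm _)).
have -> : eps / N y * (`|h| * N y / N x) = (N x)^-1 * (eps * `|h|).
  by field; rewrite !gt_eqF.
have -> : (N x)^-1 * N (x + h *: y) + (N x)^-1 * N (x - h *: y) - 2 =
   (N x)^-1 * (N (x + h *: y) + N (x - h *: y) - 2 * N x).
  by field; rewrite gt_eqF.
by rewrite ler_pM2l// invr_gt0.
Qed.

Lemma smooth_at_gateaux : (forall x, N x = 1 -> smooth_at N x) ->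
  gateaux_smooth N.
Proof.
move=> Ns x Nx y Ny; apply/cvgrPdist_le => eps e0.
have [d d0 H] := Ns x Nx y _ e0.
exists d => //= h /=; rewrite sub0r normrN => hd h0.
rewrite sub0r normrN normrM normfV ler_pdivrMr ?normr_gt0//.
have := second_difference_ge0 x (h *: y).
by rewrite Nx mulr1 => /ger0_norm ->; have := H h hd; rewrite Nx mulr1.
Qed.

(** Convexity makes this quotient nondecreasing in [h > 0], and it is bounded below by [- N y]; the
    right derivative is therefore the infimum [dder]. *)
Let diffq x y (h : R) := (N (x + h *: y) - N x) / h.

Let diffq_ge x y (h : R) : 0 < h -> - N y <= diffq x y h.
Proof.
move=> h0; rewrite /diffq ler_pdivlMr//.
have := ND (x + h *: y) (- (h *: y)).
by rewrite addrK (is_normN N_norm) NZ gtr0_norm//; lra.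
Qed.

Let diffq_mono x y (h k : R) : 0 < h -> h <= k -> diffq x y h <= diffq x y k.
Proof.
move=> h0 hk; have k0 := lt_le_trans h0 hk.
rewrite /diffq ler_pdivrMr// mulrAC ler_pdivlMr//.
have := ND ((1 - h / k) *: x) ((h / k) *: (x + k *: y)).
have hk1 : 0 <= 1 - h / k by rewrite subr_ge0 ler_pdivrMr// mul1r.
have -> : (1 - h / k) *: x + (h / k) *: (x + k *: y) = x + h *: y.
  by rewrite scalerDr addrA -scalerDl subrK scale1r scalerA divfK ?gt_eqF.
have hk0 : 0 <= h / k by rewrite divr_ge0 ?ltW.
rewrite !NZ (ger0_norm hk1) (ger0_norm hk0).
have -> : (1 - h / k) * N x + h / k * N (x + k *: y) =
  N x + (N (x + k *: y) - N x) * h / k by field; rewrite gt_eqF.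
by move=> H; rewrite -ler_pdivlMr//; lra.
Qed.

Let dder x y := inf [set diffq x y h | h in [set h : R | 0 < h]].

Let dder_lb x y : has_lbound [set diffq x y h | h in [set h : R | 0 < h]].
Proof. by exists (- N y) => _ [h h0 <-]; exact: diffq_ge. Qed.

Let dder_le x y (h : R) : 0 < h -> dder x y <= diffq x y h.
Proof. by move=> h0; apply: inf_lbound => //; exists h. Qed.

Let dder_ge x y (a : R) : (forall h : R, 0 < h -> a <= diffq x y h) -> a <= dder x y.
Proof.
move=> H; apply: lb_le_inf => [|_ [h h0 <-]]; last exact: H.
by exists (diffq x y 1), 1 => //=.
Qed.

Let dder_approx x y (eps : R) : 0 < eps -> exists2 d : R, 0 < d &
  forall h : R, 0 < h -> h <= d -> diffq x y h < dder x y + eps.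
Proof.
move=> e0; have [|_ [d /= d0 <-] H] := @inf_adherent _ _ eps e0 (conj _ (dder_lb x y)).
  by exists (diffq x y 1), 1 => //=.
by exists d => // h h0 hd; apply: le_lt_trans H; exact: diffq_mono.
Qed.

(** The point [x + h *: (y + z)] is the midpoint of [x + (2 * h) *: y] and [x + (2 * h) *: z], so
    convexity gives subadditivity; the minimum of the two thresholds keeps [2 * h] admissible for
    both. *)
Let dderD x y z : dder x (y + z) <= dder x y + dder x z.
Proof.
apply/ler_addgt0Pr => /= eps e0.
have e20 : 0 < eps / 2 by lra.
have [d d0 H] := dder_approx x y e20.
have [k k0 K] := dder_approx x z e20.
pose h := Num.min d k / 2.
have h0 : 0 < h by rewrite divr_gt0// lt_min d0.
have hd : 2 * h <= d by rewrite /h mulrC divfK// ge_min lexx.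
have hk : 2 * h <= k by rewrite /h mulrC divfK// ge_min lexx orbT.
have h20 : 0 < 2 * h by lra.
have := H _ h20 hd; have := K _ h20 hk.
have := dder_le x (y + z) h0.
suff : diffq x (y + z) h <= diffq x y (2 * h) + diffq x z (2 * h) by lra.
rewrite /diffq -mulrDl ler_pdivrMr//.
rewrite [leRHS](_ : _ = 2^-1 * (N (x + (2 * h) *: y) + N (x + (2 * h) *: z)) - N x);
  last by field; rewrite gt_eqF.
have := ND (2^-1 *: (x + (2 * h) *: y)) (2^-1 *: (x + (2 * h) *: z)).
have -> : 2^-1 *: (x + (2 * h) *: y) + 2^-1 *: (x + (2 * h) *: z) =
    x + h *: (y + z).
  rewrite !scalerDr !scalerA mulrA mulVf// mul1r addrACA -scalerDl.
  by rewrite (_ : 2^-1 + 2^-1 = 1) ?scale1r//; field.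
rewrite !NZ ger0_norm ?invr_ge0//; lra.
Qed.

Let dderZ_le x y (t : R) : 0 < t -> dder x (t *: y) <= t * dder x y.
Proof.
move=> t0; rewrite mulrC -ler_pdivrMr//; apply: dder_ge => h h0.
rewrite ler_pdivrMr//.
have ht : 0 < h / t by rewrite divr_gt0.
apply: le_trans (dder_le x (t *: y) ht) _.
by rewrite /diffq scalerA divfK ?gt_eqF// invf_div mulrAC mulrA.
Qed.

Let dderZ x y (t : R) : 0 < t -> dder x (t *: y) = t * dder x y.
Proof.
move=> t0; apply/eqP; rewrite eq_le dderZ_le//=.
have it0 : 0 < t^-1 by rewrite invr_gt0.
have := dderZ_le x (t *: y) it0.
by rewrite scalerA mulVf ?gt_eqF// scale1r ler_pdivlMl// mulrC.
Qed.

(** The right derivative at [x] is sublinear and dominated by [N]. Smoothness makes it odd, hence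
    linear, so it is a support functional. *)
Lemma smooth_support x : smooth_at N x ->
  exists f : Z -> R, [/\ lin f, forall y, f y <= N y & f x = N x].
Proof.
move=> sx; exists (dder x).
have leN y : dder x y <= N y.
  apply: le_trans (dder_le x y ltr01) _.
  by rewrite /diffq divr1 scale1r; have := ND x y; lra.
have d0 : dder x 0 = 0.
  apply/eqP; rewrite eq_le; apply/andP; split; first by rewrite -N0 leN.
  by apply: dder_ge => h h0; rewrite /diffq scaler0 addr0 subrr mul0r.
have dN y : dder x (- y) = - dder x y.
  apply/eqP; rewrite eq_le; apply/andP; split; last first.
    have := dderD x y (- y); rewrite subrr d0; lra.
  (* The sum of the derivatives along [y] and [- y] is at most the second difference divided by the
     step, which smoothness makes smaller than any [eps]. *)
  apply/ler_addgt0Pr => /= eps e0.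
  have [d d0' /(_ (d / 2))] := sx y _ e0.
  have dd0 : 0 < d / 2 by lra.
  have -> : `|d / 2| < d by rewrite gtr0_norm//; lra.
  move=> /(_ isT); rewrite gtr0_norm//.
  have := dder_le x y dd0; have := dder_le x (- y) dd0.
  rewrite /diffq !ler_pdivlMr// scalerN.
  rewrite -[_ <= - _ + eps](ler_pM2r dd0); lra.
have dA y z : dder x (y + z) = dder x y + dder x z.
  apply/eqP; rewrite eq_le dderD/=.
  have := dderD x (y + z) (- z); rewrite addrK dN; lra.
split => //.
  move=> a y z; rewrite dA; congr (_ + _).
  have [a0|a0|->] := ltgtP a 0; last by rewrite scale0r mul0r.
    rewrite -[a]opprK scaleNr dN dderZ ?oppr_gt0//; ring.
  by rewrite dderZ.
apply/eqP; rewrite eq_le leN /=; apply: dder_ge => h h0; rewrite /diffq.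
have -> : x + h *: x = (1 + h) *: x by rewrite scalerDl scale1r.
rewrite NZ ger0_norm; last lra.
by rewrite ler_pdivlMr//; lra.
Qed.

End functionals.

(** * The operator from l2 *)

(** A free ultrafilter makes all bounded real sequences converge at once. It replaces diagonal
    extraction in [norm_D_attained] and weak sequential compactness in the reflexive case. *)
Lemma ultrafilter_limits (R : realType) : exists U : set_system nat,
  [/\ ProperFilter U, \oo `<=` U &
  forall (u : nat -> R) (M : R), (forall n, `|u n| <= M) ->
    exists l : R, u @ U --> l].
Proof.
have [U [UU ooU]] := ultraFilterLemma (eventually_filter).
exists U; split => //; first exact: ultra_proper.
move=> u M uM; have UP : ProperFilter U by exact: ultra_proper.
have /(_ (u @ U) _) [|p [_ clp]] := @segment_compact R (- M) M.
  by apply: (@filterE _ U) => n /=; rewrite in_itv/= -ler_norml.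
exists p => V Vp; have [//|UV] := in_ultra_setVsetC (u @^-1` V) UU.
by have /(_ UV Vp) [x []] := clp (~` V) V.
Qed.

(** * Real estimates and square-summable sequences *)

Section real_facts.
Context {R : realType}.

Lemma le0_harmonic (x K : R) : (forall n : nat, x <= K / n.+1%:R) -> x <= 0.
Proof.
move=> H; rewrite leNgt; apply/negP => x0.
have [n Hn] : exists n : nat, K / x < n.+1%:R.
  have [n _ /(_ n (leqnn n)) /= h] := nbhs_infty_gtr (K / x).
  by exists n; rewrite (lt_trans h)// ltr_nat.
have := H n; rewrite leNgt ltr_pdivrMr//.
by move: Hn; rewrite ltr_pdivrMr// mulrC => ->.
Qed.

(** Telescoping: [1/(j+1)^2] is at most [1/j - 1/(j+1)]. *)
Lemma sum_invsqr_le (n m : nat) : (n.+2 <= m)%N ->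
  \sum_(n.+2 <= k < m) ((k%:R : R) ^+ 2)^-1 <= n.+1%:R^-1.
Proof.
move=> nm.
suff : \sum_(n.+2 <= k < m) ((k%:R : R) ^+ 2)^-1 <= n.+1%:R^-1 - m.-1%:R^-1.
  by move=> /le_trans; apply; rewrite gerBl invr_ge0.
rewrite -(subnKC nm); elim: (m - n.+2)%N => [|k IH].
  by rewrite addn0 big_geq//= subrr.
rewrite addnS big_nat_recr/=; last by rewrite leq_addr.
apply: le_trans (lerD IH (lexx _)) _; rewrite addSn/=.
rewrite -addrA lerD2l -lerBrDl opprK addrC.
set j := (n.+1 + k)%N.
have j0 : (0 : R) < j%:R by rewrite ltr0n.
rewrite -natr1 -subr_ge0.
have -> : (j%:R : R)^-1 - (j%:R + 1)^-1 - ((j%:R + 1) ^+ 2)^-1 =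
  (j%:R * (j%:R + 1) ^+ 2)^-1.
  by field; rewrite !gt_eqF// addr_gt0.
by rewrite invr_ge0 mulr_ge0 ?sqr_ge0 ?ltW.
Qed.

(** An upper bound for the l2-norm over positive indices, phrased by partial sums so that no
    convergence has to be carried along; [l2_ballP] links it to [l2_ball]. *)
Definition l2le (a : nat -> R) (b : R) :=
  0 <= b /\ forall n, \sum_(1 <= k < n) a k ^+ 2 <= b ^+ 2.

Lemma l2le_bound a (b : R) : l2le a b -> forall k, (0 < k)%N -> `|a k| <= b.
Proof.
move=> [b0 ab] k k0; rewrite -(ler_pXn2r (n := 2))// ?nnegrE//.
rewrite real_normK ?num_real//; apply: le_trans (ab k.+1).
rewrite big_nat_recr//= lerDr sumr_ge0// => i _; exact: sqr_ge0.
Qed.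

Lemma l2le0 : l2le (fun=> 0) 0.
Proof. by split=> // n; rewrite big1// => i _; rewrite expr0n. Qed.

Lemma l2leZ t a b : l2le a b -> l2le (fun k => t * a k) (`|t| * b).
Proof.
move=> [b0 ab]; split=> [|n]; first by rewrite mulr_ge0.
under eq_bigr do rewrite exprMn.
by rewrite -mulr_sumr exprMn real_normK ?num_real// ler_wpM2l// sqr_ge0.
Qed.

Lemma l2leW a (b b' : R) : l2le a b -> b <= b' -> l2le a b'.
Proof.
move=> [b0 ab] bb'; split=> [|n]; first exact: le_trans bb'.
by apply: le_trans (ab n) _; rewrite lerXn2r// nnegrE (le_trans b0).
Qed.

Lemma l2le_eq0 a : l2le a 0 -> forall k, (0 < k)%N -> a k = 0.
Proof. by move=> /l2le_bound H k /H; rewrite normr_le0 => /eqP. Qed.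

(** Minkowski's inequality, summed from the weighted bound [(a+b)^2 <= (s+t)/s a^2 + (s+t)/t b^2],
    whose defect is [(t a - s b)^2 / (s t)]. The cases [s = 0] and [t = 0] are separate because of
    the divisions. *)
Lemma l2leD a b s t : l2le a s -> l2le b t -> l2le (fun k => a k + b k) (s + t).
Proof.
move=> la lb; have [s0 las] := la; have [t0 lbt] := lb.
split=> [|n]; first exact: addr_ge0.
have [s0'|s_gt0] := eqVneq s 0.
  rewrite s0' add0r; apply: le_trans (lbt n).
  rewrite big_nat_cond [leRHS]big_nat_cond ler_sum// => i /andP[/andP[i0 _] _].
  by rewrite (l2le_eq0 (a := a)) ?add0r// -s0'.
have [t0'|t_gt0] := eqVneq t 0.
  rewrite t0' addr0; apply: le_trans (las n).
  rewrite big_nat_cond [leRHS]big_nat_cond ler_sum// => i /andP[/andP[i0 _] _].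
  by rewrite (l2le_eq0 (a := b)) ?addr0// -t0'.
have {s_gt0}s1 : 0 < s by rewrite lt_neqAle eq_sym s_gt0.
have {t_gt0}t1 : 0 < t by rewrite lt_neqAle eq_sym t_gt0.
apply: (@le_trans _ _ (\sum_(1 <= k < n)
    ((s + t) / s * a k ^+ 2 + (s + t) / t * b k ^+ 2))).
  apply: ler_sum => i _; rewrite -subr_ge0.
  have -> : (s + t) / s * a i ^+ 2 + (s + t) / t * b i ^+ 2 - (a i + b i) ^+ 2
    = (t * a i - s * b i) ^+ 2 / (s * t) by field; rewrite !gt_eqF.
  by rewrite divr_ge0 ?sqr_ge0// mulr_ge0.
rewrite big_split/= -!mulr_sumr.
have -> : (s + t) ^+ 2 = (s + t) / s * s ^+ 2 + (s + t) / t * t ^+ 2.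
  by field; rewrite !gt_eqF.
by rewrite lerD// ler_wpM2l// divr_ge0// addr_ge0.
Qed.

Lemma l2_ballP a : l2_ball a <-> l2le a 1.
Proof.
have nd : {homo (fun n => \sum_(1 <= k < n) a k ^+ 2) : n m / (n <= m)%N >-> n <= m}.
  move=> n m nm; have [n1|n1] := leqP n 1.
    by rewrite big_geq// sumr_ge0// => i _; exact: sqr_ge0.
  rewrite (big_cat_nat _ nm)/=; last exact: ltnW.
  by rewrite lerDl sumr_ge0// => i _; exact: sqr_ge0.
split.
  move=> [cva sa]; split=> // n; rewrite expr1n.
  apply: le_trans (nondecreasing_cvgn_le nd cva n) _.
  have l0 : 0 <= limn (fun n => \sum_(1 <= k < n) a k ^+ 2).
    by apply: le_trans (nondecreasing_cvgn_le nd cva 0); rewrite big_geq.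
  rewrite -(sqr_sqrtr l0) -[leRHS](expr1n _ 2) lerXn2r ?nnegrE// sqrtr_ge0.
move=> [_ la].
have cva : cvgn (fun n => \sum_(1 <= k < n) a k ^+ 2).
  apply: nondecreasing_is_cvgn => //; exists 1 => _ [n _ <-].
  by rewrite (le_trans (la n))// expr1n.
split => //; rewrite -sqrtr1 ler_wsqrtr//.
apply: limr_le => //; apply: nearW => n.
by rewrite (le_trans (la n))// expr1n.
Qed.

End real_facts.

(** * The operator [T_op], its partial sums and its composition with functionals *)

Section T_operator.
Context {R : realType} {X : completeNormedModType R} {T : X -> R} {e : nat -> X}.
Hypothesis T_equiv : equivalent_norm T.
Hypothesis T_e : forall n, (0 < n)%N -> T (e n) = 1.
Let T_norm : is_norm T := proj1 T_equiv.

Definition T_wt (k : nat) : R := if k == 1%N then Num.sqrt 2 else (k%:R ^+ 2)^-1.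

Definition T_part (a : nat -> R) n : X := \sum_(1 <= k < n) (T_wt k * a k) *: e k.

Lemma T_part2 a n : T_part a n.+2 = (Num.sqrt 2 * a 1%N) *: e 1%N +
  \sum_(2 <= k < n.+2) (((k%:R ^+ 2)^-1 * a k) *: e k).
Proof.
rewrite /T_part big_ltn// /T_wt eqxx; congr (_ + _).
by rewrite big_nat_cond [RHS]big_nat_cond; apply: eq_bigr => -[|[|k]].
Qed.

Lemma norm_equiv_bound : exists2 K : R, 0 < K &
  forall x : X, `|x| <= K * T x /\ T x <= K * `|x|.
Proof.
have [_ [c [C [c0 C0 H]]]] := T_equiv.
exists (Num.max c^-1 C); first by rewrite lt_max C0 orbT.
move=> x; have /andP[H1 H2] := H x; split.
  apply: (@le_trans _ _ (c^-1 * T x)); first by rewrite ler_pdivlMl.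
  by rewrite ler_wpM2r ?is_norm_ge0// le_max lexx.
by apply: le_trans H2 _; rewrite ler_wpM2r// le_max lexx orbT.
Qed.

Lemma T_norm_sum (s : seq nat) (P : pred nat) (F : nat -> X) :
  T (\sum_(i <- s | P i) F i) <= \sum_(i <- s | P i) T (F i).
Proof.
elim/big_ind2 : _ => //; first by rewrite is_norm0.
by move=> x a y b Hx Hy; apply: le_trans (is_normD T_norm _ _) (lerD Hx Hy).
Qed.

Let S (a : nat -> R) n : X := \sum_(2 <= k < n) (((k%:R ^+ 2)^-1 * a k) *: e k).

Let S_diff a (M : R) : (forall k, (0 < k)%N -> `|a k| <= M) -> forall n m,
  (n.+2 <= m)%N -> T (S a m - S a n.+2) <= M / n.+1%:R.
Proof.
move=> aM n m nm; have M0 : 0 <= M by apply: le_trans (aM 1%N isT).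
rewrite /S (big_cat_nat _ nm)//= addrAC subrr add0r.
apply: le_trans (T_norm_sum _ _ _) _.
apply: le_trans (ler_wpM2l M0 (sum_invsqr_le nm)).
rewrite mulr_sumr big_nat_cond [leRHS]big_nat_cond; apply: ler_sum.
move=> k /andP[/andP[nk _] _].
rewrite is_normZ// T_e ?(leq_trans _ nk)// mulr1 normrM ger0_norm ?invr_ge0 ?sqr_ge0//.
by rewrite mulrC ler_wpM2r ?invr_ge0 ?sqr_ge0// aM// (leq_trans _ nk).
Qed.

Let S_cvg a (M : R) : (forall k, (0 < k)%N -> `|a k| <= M) -> cvgn (S a).
Proof.
move=> aM; have [K K0 HK] := norm_equiv_bound.
apply/cauchy_cvgP; apply: cauchy_exP => eps e0.
have [n Hn] : exists n : nat, K * M / n.+1%:R < eps.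
  apply: contrapT => /forallNP H.
  suff : eps <= 0 by rewrite leNgt e0.
  by apply: (@le0_harmonic _ _ (K * M)) => n; rewrite leNgt; apply/negP/H.
exists (S a n.+2); exists n.+2 => // m nm /=.
rewrite -ball_normE /ball_/= distrC; apply: le_lt_trans Hn.
apply: le_trans (HK _).1 _; rewrite -mulrA ler_pM2l//.
exact: S_diff.
Qed.

(** The weights [1/k^2] give an explicit rate that depends only on a bound of the coordinates. This
    uniform tail estimate is what stands for compactness of the image of the l2 ball. *)
Lemma T_op_approx a (M : R) : (forall k, (0 < k)%N -> `|a k| <= M) ->
  forall n, T (T_op e a - T_part a n.+2) <= M / n.+1%:R.
Proof.
move=> aM n; rewrite T_part2 /T_op opprD addrACA subrr add0r.
have [K K0 HK] := norm_equiv_bound.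
apply/ler_addgt0Pr => /= eps e0.
have /cvgrPdist_lt /(_ (eps / K)) := S_cvg aM.
rewrite divr_gt0// => /(_ isT) [m _ Hm].
(* One index beyond [m] and beyond [n.+2]: there the series is close to its limit and the tail
   estimate applies. *)
have := Hm (maxn m n.+2) (leq_maxl _ _).
set l := limn _; set k := maxn _ _ => Hl.
have -> : limn (S a) - S a n.+2 = (S a k - S a n.+2) + (l - S a k).
  by rewrite [RHS]addrC subrKA.
apply: le_trans (is_normD T_norm _ _) (lerD _ _).
  by apply: S_diff => //; rewrite leq_maxr.
apply: le_trans (HK _).2 _; rewrite mulrC -ler_pdivlMr//; exact: ltW.
Qed.

Lemma T_part_lin s a b n :
  T_part (fun k => s * a k + b k) n = s *: T_part a n + T_part b n.
Proof.
rewrite /T_part scaler_sumr -big_split; apply: eq_bigr => k _ /=.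
by rewrite scalerA -scalerDl; congr (_ *: _); ring.
Qed.

Lemma T_op_lin (s : R) (a b : nat -> R) (M M' : R) : (forall k, (0 < k)%N -> `|a k| <= M) ->
  (forall k, (0 < k)%N -> `|b k| <= M') ->
  T_op e (fun k => s * a k + b k) = s *: T_op e a + T_op e b.
Proof.
move=> aM bM; apply/eqP; rewrite -subr_eq0; apply/eqP; apply: (is_norm_eq0 T_norm).
apply/eqP; rewrite eq_le is_norm_ge0// andbT.
apply: (@le0_harmonic _ _ (2 * (`|s| * M + M'))) => n.
have abM k : (0 < k)%N -> `|s * a k + b k| <= `|s| * M + M'.
  move=> k0; apply: le_trans (ler_normD _ _) _.
  by rewrite normrM lerD ?bM// ler_wpM2l// aM.
have Ha := T_op_approx aM n; have Hb := T_op_approx bM n.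
have Hab := T_op_approx abM n; rewrite T_part_lin in Hab.
set A := T_op e a in Ha *; set B := T_op e b in Hb *.
set pa := T_part a _ in Ha Hab; set pb := T_part b _ in Hb Hab.
set AB := T_op _ _ in Hab *.
have -> : AB - (s *: A + B) =
    (AB - (s *: pa + pb)) - (s *: (A - pa) + (B - pb)).
  by rewrite scalerBr [s *: A - _ + _]addrACA -opprD opprB subrKA.
apply: le_trans (is_normB T_norm _ _) _.
have -> : 2 * (`|s| * M + M') / n.+1%:R = (`|s| * M + M') / n.+1%:R +
  (`|s| * (M / n.+1%:R) + M' / n.+1%:R) by ring.
apply: lerD => //; apply: le_trans (is_normD T_norm _ _) _.
by rewrite is_normZ// lerD// ler_wpM2l.
Qed.

(** The first coordinate contributes at most [2 * M] and the tail at most [M]; the constant 4 is a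
    convenient round bound. *)
Lemma T_op_norm_le a (M : R) : (forall k, (0 < k)%N -> `|a k| <= M) ->
  T (T_op e a) <= 4 * M.
Proof.
move=> aM; have M0 : 0 <= M by apply: le_trans (aM 1%N isT).
have := T_op_approx aM 0; rewrite T_part2 big_geq// addr0 divr1 => H.
have := is_norm_split T_norm (T_op e a) ((Num.sqrt 2 * a 1%N) *: e 1%N).
rewrite is_normZ// T_e// mulr1 normrM ger0_norm ?sqrtr_ge0// => /le_trans; apply.
have s2 : Num.sqrt (2 : R) <= 2.
  have := sqr_sqrtr (ler0n R 2); have := sqrtr_ge0 (2 : R); nra.
have : Num.sqrt 2 * `|a 1%N| <= 2 * M by rewrite ler_pM ?sqrtr_ge0// aM.
lra.
Qed.

Lemma lin_T_op_approx (f : X -> R) (K : R) a (M : R) : lin f -> (forall x, `|f x| <= K * T x) ->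
  0 <= K -> (forall k, (0 < k)%N -> `|a k| <= M) -> forall n,
  `|f (T_op e a) - \sum_(1 <= k < n.+2) (T_wt k * f (e k)) * a k|
    <= K * M / n.+1%:R.
Proof.
move=> fl fK K0 aM n.
have -> : \sum_(1 <= k < n.+2) (T_wt k * f (e k)) * a k = f (T_part a n.+2).
  rewrite /T_part lin_sum//; apply: eq_bigr => k _.
  by rewrite linZ//; ring.
rewrite -linB//; apply: le_trans (fK _) _.
by rewrite -mulrA ler_wpM2l// T_op_approx.
Qed.

(** Identifies [f \o T_op e] with the pairing against the sequence [T_wt k * f (e k)]; for a support
    functional of the gauge this sequence is [c] below. *)
Lemma lin_T_op (f : X -> R) (K : R) a (M : R) : lin f -> (forall x, `|f x| <= K * T x) ->
  0 <= K -> (forall k, (0 < k)%N -> `|a k| <= M) ->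
  (\sum_(1 <= k < n) (T_wt k * f (e k)) * a k) @[n --> \oo] --> f (T_op e a).
Proof.
move=> fl fK K0 aM; have M0 : 0 <= M by apply: le_trans (aM 1%N isT).
apply/cvgrPdist_le => eps e0.
have [n Hn] : exists n : nat, K * M / n.+1%:R < eps.
  apply: contrapT => /forallNP H.
  suff : eps <= 0 by rewrite leNgt e0.
  by apply: (@le0_harmonic _ _ (K * M)) => n; rewrite leNgt; apply/negP/H.
exists n.+2 => // -[|[|m]]//= nm.
apply: le_trans (lin_T_op_approx fl fK K0 aM m) _.
apply: le_trans (ltW Hn); rewrite ler_wpM2l ?mulr_ge0//.
by rewrite lef_pV2 ?posrE ?ltr0n// ler_nat.
Qed.

Lemma T_op_coordinate (f : X -> R) K a (M : R) m : lin f ->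
  (forall x, `|f x| <= K * T x) -> 0 <= K ->
  (forall k, (0 < k)%N -> `|a k| <= M) -> (0 < m)%N ->
  (forall k, (0 < k)%N -> f (e k) = (k == m)%:R) ->
  f (T_op e a) = T_wt m * a m.
Proof.
move=> fl fK K0 aM m0 fe; apply/esym.
apply: (cvg_unique _ _ (lin_T_op fl fK K0 aM)) => //.
apply: cvg_near_cst; exists m.+1 => // n /= mn.
rewrite (bigD1_seq m)/= ?mem_index_iota ?iota_uniq ?m0// fe// eqxx mulr1.
rewrite big_nat_cond big1 ?addr0// => k /andP[/andP[k0 _] km].
by rewrite fe// (negbTE km) mulr0 mul0r.
Qed.

End T_operator.

Arguments T_part {R X} e a n.

(** * The gauge of D *)

Lemma cvg_bigsum (R : realType) (F : set_system nat) (FF : Filter F)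
    (u : nat -> nat -> R) (l : nat -> R) (m n : nat) :
  (forall k, (m <= k)%N -> u k @ F --> l k) ->
  (\sum_(m <= k < n) u k i) @[i --> F] --> \sum_(m <= k < n) l k.
Proof.
move=> H; have [nm|mn] := leqP n m.
  rewrite big_geq//; under eq_fun do rewrite big_geq//.
  exact: cvg_cst.
rewrite -(subnKC (ltnW mn)); elim: (n - m)%N => [|k IH].
  rewrite addn0 big_geq//; under eq_fun do rewrite big_geq//.
  exact: cvg_cst.
rewrite addnS big_nat_recr ?leq_addr//=.
under eq_fun do rewrite big_nat_recr ?leq_addr//=.
by apply: cvgD => //; apply: H; rewrite leq_addr.
Qed.

Lemma convex_hull_convex (R : realType) (Z : lmodType R) (A : set Z) x y (l : R) :
  0 <= l -> l <= 1 -> convex_hull A x -> convex_hull A y ->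
  convex_hull A (l *: x + (1 - l) *: y).
Proof.
move=> l0 l1 Ax Ay C [Cc AC].
have := Cc x y (Itv01 l0 l1); rewrite !inE; apply; first exact: (Ax _ (conj Cc AC)).
exact: (Ay _ (conj Cc AC)).
Qed.

Section gauge_norm.
Context {R : realType} {X : completeNormedModType R} {T : X -> R} {e : nat -> X}.
Hypothesis T_equiv : equivalent_norm T.
Hypothesis T_e : forall n, (0 < n)%N -> T (e n) = 1.
Let T_norm : is_norm T := proj1 T_equiv.
Let T_ge0 := is_norm_ge0 T_norm.

Lemma T_opZ (t : R) a b : l2le a b ->
  T_op e (fun k => t * a k) = t *: T_op e a.
Proof.
move=> /l2le_bound H.
have := @T_op_lin _ _ _ _ T_equiv T_e (t - 1) a a _ _ H H.
rewrite -[X in _ = _ + X]scale1r -scalerDl subrK => <-.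
by congr (T_op e _); apply/funext => k; ring.
Qed.

Lemma T_opD a b s t : l2le a s -> l2le b t ->
  T_op e (fun k => a k + b k) = T_op e a + T_op e b.
Proof.
move=> /l2le_bound Ha /l2le_bound Hb.
have := @T_op_lin _ _ _ _ T_equiv T_e 1 a b _ _ Ha Hb.
rewrite scale1r => <-.
by congr (T_op e _); apply/funext => k; rewrite mul1r.
Qed.

Lemma T_op0 : T_op e (fun=> 0) = 0.
Proof.
have := T_opZ 0 (l2le0 (R := R)); rewrite scale0r => <-.
by congr (T_op e _); apply/funext => k; rewrite mul0r.
Qed.

(** The gauge of [D] is the infimal convolution of [T] and the gauge of the l2 image. Upper bounds
    [al], [be] are recorded instead of the norms themselves, so that decompositions can be added and
    scaled. *)
Definition decomposes (x : X) (al be : R) (u : X) (a : nat -> R) :=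
  [/\ 0 <= al, T u <= al, l2le a be & x = u + T_op e a].

Lemma decomposesZ (t : R) x al be u a : decomposes x al be u a ->
  decomposes (t *: x) (`|t| * al) (`|t| * be) (t *: u) (fun k => t * a k).
Proof.
move=> [al0 ua la ->]; split.
- by rewrite mulr_ge0.
- by rewrite is_normZ// ler_wpM2l.
- exact: l2leZ.
- by rewrite (T_opZ _ la) scalerDr.
Qed.

Lemma decomposesD x al be u a x' al' be' u' a' : decomposes x al be u a ->
  decomposes x' al' be' u' a' ->
  decomposes (x + x') (al + al') (be + be') (u + u') (fun k => a k + a' k).
Proof.
move=> [al0 ua la ->] [al0' ua' la' ->]; split.
- exact: addr_ge0.
- exact: le_trans (is_normD T_norm _ _) (lerD _ _).
- exact: l2leD.
- by rewrite (T_opD la la') addrACA.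
Qed.

(** Vectors with a decomposition of total size at most 1 form a convex set containing both
    generators, hence the hull. *)
Lemma D_set_decomposes x : D_set T e x ->
  exists al be u a, al + be <= 1 /\ decomposes x al be u a.
Proof.
move: x; apply: smallest_sub => [x y l|x].
  rewrite !inE => -[al [be [u [a [ab dx]]]]] [al' [be' [u' [a' [ab' dy]]]]].
  have l0 : 0 <= l%:num by [].
  have l1 : 0 <= 1 - l%:num by rewrite subr_ge0.
  have := decomposesD (decomposesZ l%:num dx) (decomposesZ (1 - l%:num) dy).
  rewrite !ger0_norm// => H; do 4 eexists; split; last exact: H.
  rewrite addrACA -!mulrDr; nra.
case=> [Tx|[a /l2_ballP la <-]].
  exists 1, 0, x, (fun=> 0); split; first by rewrite addr0.
  by split=> //; [exact: l2le0|rewrite T_op0 addr0].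
exists 0, 1, 0, a; split; first by rewrite add0r.
by split=> //; rewrite ?is_norm0// add0r.
Qed.

Let p := norm_D T e.

Let p_lb x : has_lbound [set t : R | 0 < t /\ D_set T e (t^-1 *: x)].
Proof. by exists 0 => t [/ltW]. Qed.

Lemma norm_D_le x al be u a : decomposes x al be u a -> p x <= al + be.
Proof.
move=> [al0 ua la ->]; have [be0 _] := la.
apply/ler_addgt0Pr => /= eps e0.
(* Enlarging both bounds makes them positive. Then [t^-1 *: x] is the convex combination of
   [al'^-1 *: u] and [be'^-1 *: T_op e a] with weight [al' / t] on the first. *)
pose al' := al + eps / 2; pose be' := be + eps / 2.
have al'0 : 0 < al' by rewrite /al'; lra.
have be'0 : 0 < be' by rewrite /be'; lra.
have -> : al + be + eps = al' + be' by rewrite /al' /be'; field.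
set t := al' + be'.
have t0 : 0 < t by rewrite /t addr_gt0.
apply: inf_lbound => //; split=> //.
have D1 : D_set T e (al'^-1 *: u).
  apply: sub_gen_smallest; left; rewrite /closed_unit_ball/= is_normZ//.
  rewrite ger0_norm ?invr_ge0 ?(ltW al'0)// ler_pdivrMl// mulr1.
  by apply: le_trans ua _; rewrite /al'; lra.
have D2 : D_set T e (be'^-1 *: T_op e a).
  apply: sub_gen_smallest; right; exists (fun k => be'^-1 * a k); last first.
    by rewrite (T_opZ _ la).
  apply/l2_ballP; apply: l2leW (l2leZ be'^-1 la) _.
  rewrite ger0_norm ?invr_ge0 ?(ltW be'0)// ler_pdivrMl// mulr1.
  by rewrite /be'; lra.
have l0 : 0 <= al' / t by rewrite divr_ge0 ?ltW.
have l1 : al' / t <= 1 by rewrite ler_pdivrMr// mul1r /t lerDl ltW.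
have := convex_hull_convex l0 l1 D1 D2.
rewrite !scalerA mulrAC divff ?gt_eqF// mul1r.
have -> : (1 - al' / t) / be' = t^-1.
  by rewrite /t; field; rewrite !gt_eqF// addr_gt0.
by rewrite -scalerDr.
Qed.

Let p_approx x (rho : R) : p x < rho ->
  exists al be u a, al + be <= rho /\ decomposes x al be u a.
Proof.
move=> pr.
have nonempty : [set t : R | 0 < t /\ D_set T e (t^-1 *: x)] !=set0.
  have t0 : 0 < T x + 1 by rewrite ltr_wpDl.
  exists (T x + 1); split => //.
  apply: sub_gen_smallest; left; rewrite /closed_unit_ball/= is_normZ//.
  rewrite ger0_norm ?invr_ge0 ?(ltW t0)// ler_pdivrMl// mulr1; lra.
have rp : 0 < rho - p x by rewrite subr_gt0.
have [t [t0 Dt]] := inf_adherent rp (conj nonempty (p_lb x)).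
rewrite -/(gauge_of _ _) -/(norm_D _ _ _) -/p addrC subrK => tr.
have [al [be [u [a [ab /(decomposesZ t) H]]]]] := D_set_decomposes Dt.
move: H; rewrite scalerA mulfV ?gt_eqF// scale1r gtr0_norm// => H.
do 4 eexists; split; last exact: H.
by rewrite -mulrDr (le_trans _ (ltW tr))// ger_pMr.
Qed.

(** The infimum is a minimum: along the ultrafilter the bounds and all coordinates of near-optimal
    decompositions converge, and the uniform tail estimate carries this over to [T_op]. *)
Lemma norm_D_attained x :
  exists al be u a, al + be = p x /\ decomposes x al be u a.
Proof.
have [U [UP ooU Ulim]] := ultrafilter_limits R.
have /choice[f Hf] : forall n : nat, exists f : R * R * X * (nat -> R),
    f.1.1.1 + f.1.1.2 <= p x + n.+1%:R^-1 /\
    decomposes x f.1.1.1 f.1.1.2 f.1.2 f.2.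
  move=> n; have [|al [be [u [a H]]]] := @p_approx x (p x + n.+1%:R^-1).
    by rewrite ltrDl invr_gt0.
  by exists (al, be, u, a).
pose al n := (f n).1.1.1; pose be n := (f n).1.1.2.
pose u n := (f n).1.2; pose a n := (f n).2.
have dec n : decomposes x (al n) (be n) (u n) (a n) by have [] := Hf n.
have le_ab n : al n + be n <= p x + n.+1%:R^-1 by have [] := Hf n.
have al0 n : 0 <= al n by have [] := dec n.
have lbe n : l2le (a n) (be n) by have [] := dec n.
have be0 n : 0 <= be n by have [] := lbe n.
have inv1 n : (n.+1%:R : R)^-1 <= 1 by rewrite invf_le1// ler1n.
pose M := p x + 1.
have abM n : al n + be n <= M by rewrite (le_trans (le_ab n))// lerD2l.
have alM n : `|al n| <= M.
  rewrite ger0_norm//; have := abM n; have := be0 n; lra.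
have beM n : `|be n| <= M.
  rewrite ger0_norm//; have := abM n; have := al0 n; lra.
have aM k : (0 < k)%N -> forall n, `|a n k| <= M.
  move=> k0 n; apply: le_trans (l2le_bound (lbe n) k0) _.
  by apply: le_trans (beM n); exact: ler_norm.
have [al_ alc] := Ulim _ _ alM; have [be_ bec] := Ulim _ _ beM.
have /choice[a_ ac] : forall k, exists l : R, (0 < k)%N ->
    (fun n => a n k) @ U --> l.
  move=> k; have [->|k0] := posnP k; first by exists 0.
  by have [l Hl] := Ulim _ _ (aM k k0); exists l.
have al_0 : 0 <= al_.
  rewrite -(cvg_lim _ alc)//; apply: limr_ge; first by apply/cvg_ex; exists al_.
  by apply: nearW => n; exact: al0.
have be_0 : 0 <= be_.
  rewrite -(cvg_lim _ bec)//; apply: limr_ge; first by apply/cvg_ex; exists be_.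
  by apply: nearW => n; exact: be0.
have la_ : l2le a_ be_.
  split=> // m.
  have c1 : (\sum_(1 <= k < m) a i k ^+ 2) @[i --> U] -->
      \sum_(1 <= k < m) a_ k ^+ 2.
    apply: cvg_bigsum => k k0.
    by rewrite expr2; under eq_fun do rewrite expr2; apply: cvgM; exact: ac.
  have c2 : be i ^+ 2 @[i --> U] --> be_ ^+ 2.
    by rewrite expr2; under eq_fun do rewrite expr2; exact: cvgM.
  apply: ler_cvg_to c1 c2 _.
  by apply: nearW => n; have [_] := lbe n; apply.
have a_M k : (0 < k)%N -> `|a_ k| <= be_ by move=> k0; exact: l2le_bound la_ _ k0.
have abp : al_ + be_ <= p x.
  have c1 : (al i + be i) @[i --> U] --> al_ + be_ by exact: cvgD.
  have c2 : (p x + i.+1%:R^-1) @[i --> U] --> p x + 0.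
    apply: cvgD; first exact: cvg_cst.
    by apply: cvg_trans (cvg_harmonic (R := R)); apply: cvg_app.
  rewrite -[leRHS]addr0; apply: ler_cvg_to c1 c2 _.
  by apply: nearW => n; exact: le_ab.
(* The vectors [u n] are not passed to the limit; the remaining part is defined as a difference, and
   its [T]-norm is compared with that of one [u i]. *)
suff dx : decomposes x al_ be_ (x - T_op e a_) a_.
  exists al_, be_, (x - T_op e a_), a_; split => //.
  by apply/eqP; rewrite eq_le abp (norm_D_le dx).
split => //; last by rewrite subrK.
apply/ler_addgt0Pr => /= eps e0.
(* One third of [eps] each for the excess of [al i] over [al_], for the first coordinates of
   [a i - a_], and for the tail. *)
have [m Hm] : exists m : nat, (M + be_) / m.+1%:R < eps / 3.
  apply: contrapT => /forallNP H.
  suff : eps / 3 <= 0 by lra.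
  by apply: (@le0_harmonic _ _ (M + be_)) => n; rewrite leNgt; apply/negP/H.
have sc : (\sum_(1 <= k < m.+2) T_wt k * `|a i k - a_ k|) @[i --> U] --> (0 : R).
  rewrite [X in _ --> X](_ : _ = \sum_(1 <= k < m.+2) T_wt k * `|a_ k - a_ k|);
    last by rewrite big1// => k _; rewrite subrr normr0 mulr0.
  apply: (@cvg_bigsum _ _ _ (fun k i => T_wt k * `|a i k - a_ k|)
    (fun k => T_wt k * `|a_ k - a_ k|)) => k k0; apply: cvgM; first exact: cvg_cst.
  by apply: cvg_norm; apply: cvgB; [exact: ac|exact: cvg_cst].
have e30 : 0 < eps / 3 by lra.
have n1 : \forall i \near U, al i < al_ + eps / 3.
  by apply: (cvgr_lt _ alc); lra.
have n2 : \forall i \near U, \sum_(1 <= k < m.+2) T_wt k * `|a i k - a_ k| < eps / 3.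
  exact: (cvgr_lt _ sc).
have [i [h1 h2]] := filter_ex (filterI n1 n2).
have [_ ui lai xi] := dec i.
have -> : x - T_op e a_ = u i + (T_op e (a i) - T_op e a_).
  by rewrite addrA -xi.
have -> : T_op e (a i) - T_op e a_ = T_op e (fun k => a i k + -1 * a_ k).
  by rewrite (T_opD lai (l2leZ (-1) la_)) (T_opZ _ la_) scaleN1r.
have bd k : (0 < k)%N -> `|a i k + -1 * a_ k| <= M + be_.
  move=> k0; apply: le_trans (ler_normD _ _) _.
  by rewrite mulN1r normrN lerD ?aM ?a_M.
set d := (fun k => _) in bd *.
have {}Hm : T (T_op e d - T_part e d m.+2) < eps / 3.
  exact: le_lt_trans (T_op_approx T_equiv T_e bd m) Hm.
have Hp : T (T_part e d m.+2) < eps / 3.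
  apply: le_lt_trans h2.
  apply: le_trans (T_norm_sum T_equiv _ _ _) _.
  rewrite big_nat_cond [leRHS]big_nat_cond ler_sum// => k /andP[/andP[k0 _] _].
  rewrite is_normZ// T_e// mulr1 normrM /d mulN1r ger0_norm//.
  by rewrite /T_wt; case: ifP => _; rewrite ?sqrtr_ge0// invr_ge0 sqr_ge0.
have := is_normD T_norm (u i) (T_op e d).
have := is_norm_split T_norm (T_op e d) (T_part e d m.+2).
by move=> h3 h4; clear -Hm Hp h1 ui h3 h4; lra.
Qed.

Lemma norm_D_ge0 x : 0 <= p x.
Proof.
have [al [be [u [a [<- [al0 _ [be0 _] _]]]]]] := norm_D_attained x.
exact: addr_ge0.
Qed.

Lemma norm_D_le_T x : p x <= T x.
Proof.
rewrite -[leRHS]addr0; apply: (@norm_D_le _ _ _ x (fun=> 0)).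
by split => //; [exact: l2le0|rewrite T_op0 addr0].
Qed.

Lemma T_le_norm_D x : T x <= 4 * p x.
Proof.
have [al [be [u [a [<- [al0 ua la ->]]]]]] := norm_D_attained x.
apply: le_trans (is_normD T_norm _ _) _.
have := T_op_norm_le T_equiv T_e (l2le_bound la); lra.
Qed.

Lemma norm_D_T_op a b : l2le a b -> p (T_op e a) <= b.
Proof.
move=> la; rewrite -[leRHS]add0r; apply: (@norm_D_le _ _ _ 0 a).
by split; rewrite ?is_norm0// add0r.
Qed.

Lemma norm_D_is_norm : is_norm p.
Proof.
have pZ t x : p (t *: x) <= `|t| * p x.
  have [al [be [u [a [<- /(decomposesZ t)]]]]] := norm_D_attained x.
  by move=> /norm_D_le; rewrite mulrDr.
split.
- move=> x y.
  have [al [be [u [a [<- dx]]]]] := norm_D_attained x.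
  have [al' [be' [u' [a' [<- dy]]]]] := norm_D_attained y.
  by rewrite addrACA; exact: norm_D_le (decomposesD dx dy).
- move=> t x; apply/eqP; rewrite eq_le pZ/=.
  have [->|t0] := eqVneq t 0; first by rewrite normr0 mul0r norm_D_ge0.
  have := pZ t^-1 (t *: x); rewrite scalerA mulVf// scale1r normfV.
  by rewrite ler_pdivlMl// normr_gt0.
- move=> x px; apply: (is_norm_eq0 T_norm); apply/eqP.
  by rewrite eq_le T_ge0 andbT (le_trans (T_le_norm_D x))// px mulr0.
Qed.

(** A functional is bounded on [D] as soon as it is bounded on the two generating sets; used for the
    explicit functionals that refute LUR. *)
Lemma lin_le_norm_D (f : X -> R) (K : R) : 0 <= K -> lin f ->
  (forall x, f x <= K * T x) ->
  (forall a b, l2le a b -> f (T_op e a) <= K * b) -> forall x, f x <= K * p x.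
Proof.
move=> K0 fl fT fB x.
have [al [be [u [a [<- [al0 ua la ->]]]]]] := norm_D_attained x.
rewrite linD// mulrDr lerD// ?fB//; apply: le_trans (fT _) _.
by rewrite ler_wpM2l.
Qed.

End gauge_norm.

(** * Smoothness of the gauge and of its quadratic perturbation *)

Section smoothness_of_gauge.
Context {R : realType} {X : completeNormedModType R} {T : X -> R} {e : nat -> X}.
Hypothesis T_equiv : equivalent_norm T.
Hypothesis T_e : forall n, (0 < n)%N -> T (e n) = 1.
Hypothesis T_smooth : forall x, x <> 0 -> smooth_at T x.
Hypothesis e_dense : dense (lin_span e).
Let T_norm : is_norm T := proj1 T_equiv.
Let p := norm_D T e.
Let p_norm : is_norm p := norm_D_is_norm T_equiv T_e.

Lemma T_wt_gt0 k : (0 < k)%N -> 0 < T_wt k :> R.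
Proof.
move=> k0; rewrite /T_wt; case: ifP => _; first by rewrite sqrtr_gt0.
by rewrite invr_gt0 exprn_gt0// ltr0n.
Qed.

Lemma l2le_trunc (a : nat -> R) n :
  l2le (fun k => if (k < n)%N then a k else 0)
    (Num.sqrt (\sum_(1 <= k < n) a k ^+ 2)).
Proof.
have S0 i j : 0 <= \sum_(i <= k < j) a k ^+ 2.
  by rewrite sumr_ge0// => k _; exact: sqr_ge0.
split=> [|m]; first exact: sqrtr_ge0.
rewrite sqr_sqrtr//.
have [mn|nm] := leqP m n.
  have [m1|m1] := leqP m 1; first by rewrite big_geq.
  rewrite (big_cat_nat (ltnW m1) mn)/= -[leLHS]addr0 lerD//.
  rewrite le_eqVlt big_nat_cond [X in _ == X]big_nat_cond; apply/orP; left.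
  apply/eqP; apply: eq_bigr => k /andP[/andP[_ km] _].
  by rewrite (leq_trans km mn).
have tail k : (n <= k)%N -> (if (k < n)%N then a k else 0) ^+ 2 = 0.
  by move=> nk; rewrite ltnNge nk/= expr0n.
have [n1|n1] := leqP n 1.
  rewrite big_nat_cond big1// => k /andP[/andP[k1 _] _].
  by rewrite tail// (leq_trans n1).
rewrite (big_cat_nat (ltnW n1) (ltnW nm))/= [X in _ + X]big_nat_cond.
rewrite [X in _ + X]big1 ?addr0; last by move=> k /andP[/andP[/tail]].
rewrite le_eqVlt big_nat_cond [X in _ == X]big_nat_cond; apply/orP; left.
by apply/eqP; apply: eq_bigr => k /andP[/andP[_ ->] _].
Qed.

Lemma T_op_trunc (a : nat -> R) n :
  T_op e (fun k => if (k < n)%N then a k else 0) = T_part e a n.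
Proof.
set b := fun k => _; have lb := l2le_trunc a n; rewrite -/b in lb.
have part m : (n <= m)%N -> T_part e b m = T_part e a n.
  move=> nm; rewrite /T_part.
  have [n1|n1] := leqP n 1.
    rewrite [RHS]big_geq// big_nat_cond big1// => k /andP[/andP[k1 _] _].
    by rewrite /b ltnNge (leq_trans n1)//= mulr0 scale0r.
  rewrite (big_cat_nat (ltnW n1) nm)/= [X in _ + X]big_nat_cond.
  rewrite [X in _ + X]big1 ?addr0; last first.
    by move=> k /andP[/andP[nk _] _]; rewrite /b ltnNge nk/= mulr0 scale0r.
  rewrite big_nat_cond [RHS]big_nat_cond; apply: eq_bigr => k.
  by move=> /andP[/andP[_ kn] _]; rewrite /b kn.
apply/eqP; rewrite -subr_eq0; apply/eqP/(is_norm_eq0 T_norm).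
apply/eqP; rewrite eq_le is_norm_ge0// andbT.
apply: (@le0_harmonic _ _ (Num.sqrt (\sum_(1 <= k < n) a k ^+ 2))) => m.
have := T_op_approx T_equiv T_e (l2le_bound lb) (n + m).
rewrite part; last by rewrite -addn2 -addnA leq_addr.
move=> /le_trans; apply; rewrite ler_wpM2l ?sqrtr_ge0//.
by rewrite lef_pV2 ?posrE ?ltr0n// ler_nat ltnS leq_addl.
Qed.

(** A dense set of directions lies in the range of [T_op] on finitely supported sequences, where
    differentiability of the l2-norm can be used. *)
Lemma lin_span_T_op y : lin_span e y -> exists b be n,
  [/\ l2le b be, forall k, (n <= k)%N -> b k = 0 & y = T_op e b].
Proof.
move=> [n [y_ ->]].
have lb := l2le_trunc (fun k => y_ k / T_wt k) n.
do 2 eexists; exists n; split; first exact: lb.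
  by move=> k nk /=; rewrite ltnNge nk.
rewrite T_op_trunc /T_part big_nat_cond [RHS]big_nat_cond.
apply: eq_bigr => k /andP[/andP[k1 _] _].
by rewrite mulrC divfK// gt_eqF// T_wt_gt0.
Qed.

(** Expands the square of [a + h b] and uses [sqrt (rho^2 + t) <= rho + t / (2 rho)]. The number [I]
    is the inner product, a finite sum independent of [h], so the linear terms for [h] and [- h]
    cancel. *)
Lemma l2_second_difference a (rho : R) b be n : 0 < rho -> l2le a rho -> l2le b be ->
  (forall k, (n <= k)%N -> b k = 0) ->
  exists I : R, forall h : R,
    l2le (fun k => a k + h * b k) (rho + (2 * h * I + h ^+ 2 * be ^+ 2) / (2 * rho)).
Proof.
move=> rho0 [_ la] [_ lb] b0; exists (\sum_(1 <= k < n) a k * b k) => h.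
set I := \sum_(1 <= k < n) _.
pose t := 2 * h * I + h ^+ 2 * be ^+ 2; rewrite -/t.
have H m : \sum_(1 <= k < m) (a k + h * b k) ^+ 2 <= rho ^+ 2 + t.
  pose M := maxn (maxn m n) 1.
  have M1 : (1 <= M)%N by rewrite leq_maxr.
  have mM : (m <= M)%N by rewrite !leq_max leqnn.
  have nM : (n <= M)%N by rewrite !leq_max leqnn orbT.
  apply: (@le_trans _ _ (\sum_(1 <= k < M) (a k + h * b k) ^+ 2)).
    have [m1|m1] := leqP m 1.
      by rewrite big_geq// sumr_ge0// => i _; exact: sqr_ge0.
    rewrite (big_cat_nat (ltnW m1) mM)/= lerDl sumr_ge0// => i _.
    exact: sqr_ge0.
  have -> : \sum_(1 <= k < M) (a k + h * b k) ^+ 2 =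
    \sum_(1 <= k < M) a k ^+ 2 + 2 * h * (\sum_(1 <= k < M) a k * b k) +
    h ^+ 2 * \sum_(1 <= k < M) b k ^+ 2.
    rewrite !mulr_sumr -!big_split/=; apply: eq_bigr => k _; ring.
  have -> : \sum_(1 <= k < M) a k * b k = I.
    have [n1|n1] := leqP n 1.
      rewrite /I [RHS]big_geq// big_nat_cond big1// => i /andP[/andP[i1 _] _].
      by rewrite b0 ?mulr0// (leq_trans n1).
    rewrite (big_cat_nat (ltnW n1) nM)/= [X in _ + X]big_nat_cond.
    rewrite [X in _ + X]big1 ?addr0// => i /andP[/andP[ni _] _].
    by rewrite b0 ?mulr0.
  by rewrite /t addrA lerD ?lerD2r ?ler_wpM2l ?sqr_ge0.
have t0 : 0 <= rho ^+ 2 + t by apply: le_trans (H 0); rewrite big_geq.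
have rr : 0 < 2 * rho by lra.
split.
  rewrite -(pmulr_lge0 _ rr) mulrDl divfK ?gt_eqF//; nra.
move=> m; apply: le_trans (H m) _; rewrite -subr_ge0.
have -> : (rho + t / (2 * rho)) ^+ 2 - (rho ^+ 2 + t) = (t / (2 * rho)) ^+ 2.
  by field; rewrite gt_eqF.
exact: sqr_ge0.
Qed.

Lemma norm_D_smooth x : x <> 0 -> smooth_at p x.
Proof.
move=> x0 y eps e0; have px := is_norm_gt0 p_norm x0.
have [al [be [u [a [abp [al0 ua la xE]]]]]] := norm_D_attained T_equiv T_e x.
rewrite -/p in abp.
(* For [u != 0] the l2 part is kept fixed: [T (u + h *: y) + be] dominates [p (x + h *: y)], while
   [p x] is at least [T u + be]. *)
have [u0|/eqP u0] := eqVneq u 0; last first.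
  have [d d0 H] := T_smooth u0 y e0; exists d => // h hd.
  apply: le_trans (H h hd).
  have pT z : p (z + T_op e a) <= T z + be.
    apply: (norm_D_le T_equiv T_e (u := z) (a := a)).
    by split => //; exact: is_norm_ge0.
  have := pT (u + h *: y); have := pT (u - h *: y).
  rewrite xE ![u + T_op e a + _]addrAC -xE -abp; lra.
have {}xE : x = T_op e a by rewrite xE u0 add0r.
have {}la : l2le a (p x).
  by apply: l2leW la _; rewrite -abp lerDr.
have [K K0 HK] := norm_equiv_bound T_equiv.
have eK : 0 < eps / 4 / K by rewrite !divr_gt0.
(* Replacing [y] by [y'] costs [eps / 4] for each sign of [h]; the other half of [eps] pays for the
   quadratic term, and [d] is chosen for that. *)
have [y' [yy' sy']] : ball y (eps / 4 / K) `&` lin_span e !=set0.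
  by apply: e_dense; [exists y; exact: ballxx|exact: ball_open].
have {yy'} yy' : T (y - y') <= eps / 4.
  move: yy'; rewrite -ball_normE /= => /ltW H.
  apply: le_trans (HK _).2 _.
  by rewrite mulrC -ler_pdivlMr.
have [b [be' [n [lb b0 y'E]]]] := lin_span_T_op sy'.
have [I HI] := l2_second_difference px la lb b0.
have be'0 : 0 <= be' by case: lb.
pose d := eps * p x / (2 * (be' ^+ 2 + 1)).
have b1 : 0 < be' ^+ 2 + 1 by rewrite ltr_wpDl ?sqr_ge0.
exists d; first by rewrite divr_gt0 ?mulr_gt0.
move=> h hd.
have ph t : p (x + t *: y) <=
    p x + (2 * t * I + t ^+ 2 * be' ^+ 2) / (2 * p x) + `|t| * (eps / 4).
  have -> : x + t *: y = T_op e (fun k => a k + t * b k) + t *: (y - y').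
    rewrite (T_opD T_equiv T_e la (l2leZ t lb)) (T_opZ T_equiv T_e _ lb).
    by rewrite -xE -y'E scalerBr -addrA subrKC.
  apply: le_trans (is_normD p_norm _ _) _; apply: lerD.
    exact: (norm_D_T_op T_equiv T_e (HI t)).
  rewrite (is_normZ p_norm) ler_wpM2l//.
  exact: le_trans (norm_D_le_T T_equiv T_e _) yy'.
have := ph h; have := ph (- h); rewrite scaleNr normrN sqrrN => h1 h2.
have h3 : h ^+ 2 * be' ^+ 2 / p x <= `|h| * (eps / 2).
  rewrite ler_pdivrMr// -(real_normK (num_real h)) expr2 -!mulrA ler_wpM2l//.
  apply: (@le_trans _ _ (d * be' ^+ 2)).
    by rewrite ler_wpM2r ?sqr_ge0// ltW.
  rewrite /d mulrAC ler_pdivrMr; last by lra.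
  have : 0 <= eps * p x by rewrite mulr_ge0// ltW.
  nra.
have : p x + (2 * h * I + h ^+ 2 * be' ^+ 2) / (2 * p x) +
       (p x + (2 * - h * I + h ^+ 2 * be' ^+ 2) / (2 * p x)) =
       2 * p x + h ^+ 2 * be' ^+ 2 / p x by field; rewrite gt_eqF.
lra.
Qed.

End smoothness_of_gauge.

Lemma sqr_le_sqr (R : realDomainType) (z s : R) : - s <= z -> z <= s ->
  z ^+ 2 <= s ^+ 2.
Proof. by move=> sz zs; nra. Qed.

(** * Adding a quadratic form to the square of a norm *)

Section quadratic_perturbation.
Context {R : realType} {Z : lmodType R} {p : Z -> R} {B : Z -> Z -> R}.
Hypothesis p_norm : is_norm p.
Hypothesis B_lin : forall y, lin (B^~ y).
Hypothesis B_sym : forall x y, B x y = B y x.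
Hypothesis B_ge0 : forall x, 0 <= B x x.

Definition perturbed_norm x : R := Num.sqrt (p x ^+ 2 + B x x).
Let N := perturbed_norm.

Lemma perturbed_norm_sqr x : N x ^+ 2 = p x ^+ 2 + B x x.
Proof. by rewrite sqr_sqrtr// addr_ge0 ?sqr_ge0. Qed.

Lemma perturbed_norm_ge0 x : 0 <= N x.
Proof. exact: sqrtr_ge0. Qed.

Lemma le_perturbed_norm x : p x <= N x.
Proof.
rewrite -(ler_pXn2r (n := 2)) ?nnegrE ?sqrtr_ge0 ?is_norm_ge0//.
by rewrite perturbed_norm_sqr lerDl.
Qed.

Lemma B_linr x : lin (B x).
Proof. by move=> a y z; rewrite !(B_sym x) (B_lin x a y z). Qed.

Lemma B_comb (a b : R) x y : B (a *: x + b *: y) (a *: x + b *: y) =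
  a ^+ 2 * B x x + 2 * a * b * B x y + b ^+ 2 * B y y.
Proof.
rewrite (linD (B_lin _)) !(linZ (B_lin _)) !(linD (B_linr _)) !(linZ (B_linr _)).
by rewrite (B_sym y x); ring.
Qed.

Lemma B_D x y : B (x + y) (x + y) = B x x + 2 * B x y + B y y.
Proof. by have := B_comb 1 1 x y; rewrite !scale1r => ->; ring. Qed.

Lemma B_B x y : B (x - y) (x - y) = B x x - 2 * B x y + B y y.
Proof. by have := B_comb 1 (-1) x y; rewrite scale1r scaleN1r => ->; ring. Qed.

Lemma perturbed_norm_eq0 x : N x = 0 -> x = 0.
Proof.
move=> Nx; apply: (is_norm_eq0 p_norm); apply/eqP.
by rewrite eq_le is_norm_ge0// andbT -Nx le_perturbed_norm.
Qed.

(** Add the square of [N y * p x - N x * p y] to the form [B] at [N y *: x - N x *: y]: the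
    nonnegative total is [2 N x N y] times the defect of the inequality. It yields both the triangle
    inequality and the bound on [support_form]. *)
Lemma perturbed_cauchy_schwarz x y : p x * p y + B x y <= N x * N y.
Proof.
have [Nx|Nx] := eqVneq (N x) 0.
  rewrite Nx (perturbed_norm_eq0 Nx) is_norm0// !mul0r.
  by rewrite (lin0 (B_lin y)) addr0.
have [Ny|Ny] := eqVneq (N y) 0.
  rewrite Ny (perturbed_norm_eq0 Ny) is_norm0// !mulr0.
  by rewrite (lin0 (B_linr x)) addr0.
have s0 : 0 < N x by rewrite lt_neqAle eq_sym Nx perturbed_norm_ge0.
have t0 : 0 < N y by rewrite lt_neqAle eq_sym Ny perturbed_norm_ge0.
have H1 := sqr_ge0 (N y * p x - N x * p y).
have H2 := B_ge0 (N y *: x + (- N x) *: y); rewrite B_comb in H2.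
have E1 := perturbed_norm_sqr x; have E2 := perturbed_norm_sqr y.
have : 0 <= 2 * (N x * N y) * (N x * N y - (p x * p y + B x y)).
  have -> : 2 * (N x * N y) * (N x * N y - (p x * p y + B x y)) =
    N y ^+ 2 * N x ^+ 2 + N x ^+ 2 * N y ^+ 2 -
    2 * (N x * N y) * (p x * p y + B x y) by ring.
  rewrite {1}E1 {2}E2; apply: le_trans (addr_ge0 H1 H2) _.
  by rewrite le_eqVlt; apply/orP; left; apply/eqP; ring.
by rewrite pmulr_rge0 ?mulr_gt0// subr_ge0.
Qed.

Lemma perturbed_is_norm : is_norm N.
Proof.
split.
- move=> x y; rewrite -(ler_pXn2r (n := 2)) ?nnegrE ?addr_ge0 ?sqrtr_ge0//.
  rewrite perturbed_norm_sqr B_D.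
  have := is_normD p_norm x y; have := perturbed_cauchy_schwarz x y.
  have := is_norm_ge0 p_norm (x + y).
  have := perturbed_norm_sqr x; have := perturbed_norm_sqr y.
  nra.
- move=> a x; apply/eqP.
  rewrite -(eqrXn2 (n := 2)) ?mulr_ge0 ?sqrtr_ge0//; apply/eqP.
  rewrite exprMn !perturbed_norm_sqr real_normK ?num_real// (is_normZ p_norm).
  rewrite (linZ (B_lin _)) (linZ (B_linr _)) exprMn real_normK ?num_real//.
  ring.
- exact: perturbed_norm_eq0.
Qed.

(** The second difference of [N^2] equals [2 p x] times that of [p], plus squares of increments of
    [p] and [2 h^2 B y y], all of order [h^2]; smoothness of [p] controls the first term. *)
Lemma perturbed_smooth x : x <> 0 -> smooth_at p x -> smooth_at N x.
Proof.
move=> x0 px y eps e0; have Nx := is_norm_gt0 perturbed_is_norm x0.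
have r0 := is_norm_gt0 p_norm x0.
have e'0 : 0 < eps * N x / (2 * (p x + 1)).
  by rewrite divr_gt0 ?mulr_gt0// addr_gt0.
have [d d0 H] := px y _ e'0.
pose c := p y ^+ 2 + B y y.
have c0 : 0 <= c by rewrite addr_ge0 ?sqr_ge0.
have c1 : 0 < 2 * c + 1 by lra.
exists (Num.min d (eps * N x / (2 * c + 1))).
  by rewrite lt_min d0 divr_gt0// mulr_gt0.
move=> h; rewrite lt_min => /andP[/H hd].
rewrite ltr_pdivlMr// => hc.
have a0 : 0 <= `|h| by [].
have hh := real_normK (num_real h).
have A1 : p (x + h *: y) - p x <= `|h| * p y.
  by have := is_normD p_norm x (h *: y); rewrite is_normZ//; lra.
have A2 : p (x - h *: y) - p x <= `|h| * p y.
  by have := is_normB p_norm x (h *: y); rewrite is_normZ//; lra.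
have A3 := second_difference_ge0 p_norm x (h *: y).
have E1 := perturbed_norm_sqr (x + h *: y).
have E2 := perturbed_norm_sqr (x - h *: y).
have E3 := perturbed_norm_sqr x.
rewrite B_D in E1; rewrite B_B in E2.
rewrite (linZ (B_linr _)) (linZ (B_lin _)) (linZ (B_linr _)) in E1 E2.
have hd' : 2 * p x * (p (x + h *: y) + p (x - h *: y) - 2 * p x) <=
    eps * N x * `|h|.
  apply: (@le_trans _ _ (2 * p x * (eps * N x / (2 * (p x + 1)) * `|h|))).
    by rewrite ler_wpM2l// mulr_ge0// ltW.
  have -> : 2 * p x * (eps * N x / (2 * (p x + 1)) * `|h|) =
      (p x / (p x + 1)) * (eps * N x * `|h|).
    by field; rewrite gt_eqF// addr_gt0.
  rewrite ler_piMl ?mulr_ge0 ?(ltW e0) ?(ltW Nx)//.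
  by rewrite ler_pdivrMr ?addr_gt0// mul1r lerDl.
set P := p (x + h *: y) in A1 A3 E1 hd hd' *.
set M := p (x - h *: y) in A2 A3 E2 hd hd' *.
set NP := N (x + h *: y) in E1 *.
set NM := N (x - h *: y) in E2 *.
have hq : 0 <= `|h| * p y by rewrite mulr_ge0// is_norm_ge0.
(* The lower bounds on the increments come from [A3] combined with the opposite upper bound. *)
have AP : (P - p x) ^+ 2 <= h ^+ 2 * p y ^+ 2.
  by rewrite -hh -exprMn; apply: sqr_le_sqr; lra.
have AM : (M - p x) ^+ 2 <= h ^+ 2 * p y ^+ 2.
  by rewrite -hh -exprMn; apply: sqr_le_sqr; lra.
have hc2 : 2 * h ^+ 2 * c <= eps * N x * `|h| by rewrite -hh; nra.
have tot : NP ^+ 2 + NM ^+ 2 <= 2 * N x ^+ 2 + 2 * (eps * N x * `|h|).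
  rewrite E1 E2 E3; rewrite /c in hc2; nra.
have NP0 : 0 <= NP by exact: sqrtr_ge0.
have NM0 : 0 <= NM by exact: sqrtr_ge0.
have eh : 0 <= eps * `|h| by rewrite mulr_ge0// ltW.
(* Back from squares: [(NP + NM)^2 <= 2 (NP^2 + NM^2) <= 4 (N x)^2 + 4 eps N x |h|], which is at
   most [(2 N x + eps |h|)^2]. *)
rewrite lerBlDl -(ler_pXn2r (n := 2)) ?nnegrE ?addr_ge0 ?mulr_ge0 ?(ltW Nx) ?(ltW e0)//.
have := sqr_ge0 (NP - NM); have := sqr_ge0 (eps * `|h|).
nra.
Qed.

End quadratic_perturbation.

Arguments perturbed_norm {R Z} p B x.

(** * Dual norms and the weighted quadratic form *)

Section dual_norm_theory.
Context {R : realType} {Z : lmodType R} {N : Z -> R} {f : Z -> R} {M : R}.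
Hypothesis N_norm : is_norm N.
Hypothesis f_lin : lin f.
Hypothesis f_bound : forall x, `|f x| <= M * N x.

Let dual_norm_nonempty : [set `|f x| | x in closed_unit_ball N] !=set0.
Proof. by exists `|f 0|, 0 => //; rewrite /closed_unit_ball/= is_norm0. Qed.

Let dual_norm_has_sup : has_sup [set `|f x| | x in closed_unit_ball N].
Proof.
split; first exact: dual_norm_nonempty.
exists `|M| => _ [x Nx <-]; apply: le_trans (f_bound x) _.
apply: (@le_trans _ _ (`|M| * N x)); first by rewrite ler_wpM2r ?ler_norm// is_norm_ge0.
by rewrite ler_piMr.
Qed.

Lemma ball_le_dual_norm x : N x <= 1 -> `|f x| <= dual_norm N f.
Proof. by move=> Nx; apply: sup_upper_bound => //; exists x. Qed.

Lemma dual_norm_ge0 : 0 <= dual_norm N f.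
Proof.
by apply: le_trans (ball_le_dual_norm (x := 0) _); rewrite ?(is_norm0 N_norm).
Qed.

Lemma le_dual_norm x : `|f x| <= dual_norm N f * N x.
Proof.
have [->|/eqP x0] := eqVneq x 0.
  by rewrite (lin0 f_lin) normr0 (is_norm0 N_norm) mulr0.
have Nx := is_norm_gt0 N_norm x0.
rewrite -ler_pdivrMr//; apply: sup_upper_bound => //.
exists ((N x)^-1 *: x); first by rewrite /closed_unit_ball/= is_norm_unit.
by rewrite (linZ f_lin) normrM gtr0_norm ?invr_gt0// mulrC.
Qed.

(** Symmetry of the ball replaces the supremum of [|f|] by that of [f]. *)
Lemma dual_norm_approx (eps : R) : 0 < eps ->
  exists2 x, N x <= 1 & dual_norm N f - eps < f x.
Proof.
move=> e0; have [_ [x Nx <-]] := sup_adherent e0 dual_norm_has_sup.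
rewrite -/(dual_norm N f) => H; have [fx|fx] := leP 0 (f x).
  by exists x => //; rewrite -(ger0_norm fx).
exists (- x); first by rewrite is_normN.
by rewrite (linN f_lin) -(ltr0_norm fx).
Qed.

End dual_norm_theory.

(** * The weighted sum of squares of functionals *)

Section weighted_form.
Context {R : realType} {Z : lmodType R} {T : Z -> R} {F : nat -> Z -> R}.
Hypothesis F_lin : forall n, lin (F n).
Hypothesis F_le : forall n x, (2 <= n)%N -> `|F n x| <= T x.

Definition weighted_form (x y : Z) : R :=
  limn (fun n => \sum_(2 <= k < n) 2 ^- k * (F k x * F k y)).

Let psum x y n : R := \sum_(2 <= k < n) 2 ^- k * (F k x * F k y).

Let psum_le x n : psum x x n <= T x ^+ 2.
Proof.
have half m : \sum_(2 <= k < m.+2) (2 ^- k : R) <= 2^-1 - 2 ^- m.+1.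
  elim: m => [|m IH]; first by rewrite big_geq// expr1 subrr.
  rewrite big_nat_recr//=; apply: le_trans (lerD IH (lexx _)) _.
  rewrite le_eqVlt; apply/orP; left; apply/eqP.
  by rewrite [2 ^+ m.+2]exprS; field; rewrite expf_neq0.
have tot : \sum_(2 <= k < n) (2 ^- k : R) <= 1.
  case: n => [|[|n]]; [by rewrite big_geq|by rewrite big_geq|].
  have h0 : (0 : R) <= 2 ^- n.+1 by rewrite invr_ge0 exprn_ge0.
  by apply: le_trans (half n) _; lra.
apply: (@le_trans _ _ (\sum_(2 <= k < n) 2 ^- k * T x ^+ 2)).
  rewrite /psum big_nat_cond [leRHS]big_nat_cond; apply: ler_sum.
  move=> k /andP[/andP[k2 _] _]; rewrite ler_wpM2l ?invr_ge0 ?exprn_ge0//.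
  by rewrite -expr2; apply: sqr_le_sqr; have := F_le x k2; rewrite ler_norml => /andP[].
by rewrite -mulr_suml ler_piMl// sqr_ge0.
Qed.

Let psum_nd x : {homo (psum x x) : n m / (n <= m)%N >-> n <= m}.
Proof.
have s0 k : 0 <= 2 ^- k * (F k x * F k x).
  by rewrite mulr_ge0 ?invr_ge0 ?exprn_ge0// -expr2 sqr_ge0.
move=> n m nm; rewrite /psum; have [n2|n2] := leqP n 2.
  by rewrite big_geq// sumr_ge0.
by rewrite (big_cat_nat (ltnW n2) nm)/= lerDl sumr_ge0.
Qed.

Let psum_cvg_diag x : cvgn (psum x x).
Proof.
apply: nondecreasing_is_cvgn; first exact: psum_nd.
by exists (T x ^+ 2) => _ [n _ <-]; exact: psum_le.
Qed.

Let psum_cvg x y : cvgn (psum x y).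
Proof.
(* Polarization reduces convergence to the monotone diagonal sums. *)
have -> : psum x y = (fun n => 4^-1 * (psum (x + y) (x + y) n - psum (x - y) (x - y) n)).
  apply/funext => n; rewrite /psum -sumrB mulr_sumr; apply: eq_bigr => k _.
  by rewrite !(linB (F_lin k)) !(linD (F_lin k)); field; rewrite expf_neq0.
by apply: is_cvgMr; apply: is_cvgB; exact: psum_cvg_diag.
Qed.

Lemma weighted_form_lin y : lin (weighted_form^~ y).
Proof.
move=> a x z; rewrite /weighted_form.
have -> : (fun n => \sum_(2 <= k < n) 2 ^- k * (F k (a *: x + z) * F k y)) =
    (fun n => a * psum x y n + psum z y n).
  apply/funext => n; rewrite /psum mulr_sumr -big_split; apply: eq_bigr => k _ /=.
  by rewrite F_lin; ring.
apply: cvg_lim => //; apply: cvgD; last exact: psum_cvg.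
by apply: cvgM; [exact: cvg_cst|exact: psum_cvg].
Qed.

Lemma weighted_form_sym x y : weighted_form x y = weighted_form y x.
Proof.
by congr (limn _); apply/funext => n; apply: eq_bigr => k _; rewrite [F k x * _]mulrC.
Qed.

Lemma weighted_form_ge x n : psum x x n <= weighted_form x x.
Proof. by apply: nondecreasing_cvgn_le; [exact: psum_nd|exact: psum_cvg_diag]. Qed.

Lemma weighted_form_ge0 x : 0 <= weighted_form x x.
Proof. by have := weighted_form_ge x 0; rewrite /psum big_geq. Qed.

Lemma weighted_form_term x n : (2 <= n)%N -> 2 ^- n * F n x ^+ 2 <= weighted_form x x.
Proof.
move=> n2; apply: le_trans (weighted_form_ge x n.+1).
rewrite /psum big_nat_recr//= expr2 lerDr sumr_ge0// => k _.
by rewrite mulr_ge0 ?invr_ge0 ?exprn_ge0// -expr2 sqr_ge0.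
Qed.

Lemma weighted_form_le x : weighted_form x x <= T x ^+ 2.
Proof.
by apply: limr_le; [exact: psum_cvg_diag|apply: nearW => n; exact: psum_le].
Qed.

Lemma weighted_form_single x m : (2 <= m)%N ->
  (forall k, (2 <= k)%N -> k != m -> F k x = 0) ->
  weighted_form x x <= 2 ^- m * F m x ^+ 2.
Proof.
move=> m2 H; have r0 : 0 <= 2 ^- m * F m x ^+ 2.
  by rewrite mulr_ge0 ?sqr_ge0 ?invr_ge0 ?exprn_ge0.
apply: limr_le; first exact: psum_cvg_diag.
apply: nearW => n; have [mn|nm] := ltnP m n.
  rewrite (bigD1_seq m)/= ?mem_index_iota ?iota_uniq ?m2//.
  rewrite big_nat_cond big1 ?addr0 -?expr2// => k /andP[/andP[k2 _] km].
  by rewrite H// mul0r mulr0.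
rewrite big_nat_cond big1// => k /andP[/andP[k2 kn] _].
by rewrite H ?mul0r ?mulr0// neq_ltn (leq_trans kn nm).
Qed.

End weighted_form.

Arguments weighted_form {R Z} F x y.

(** * Slices of the unit ball *)

Section LUR_exposure.
Context {R : realType} {Z : lmodType R} {T : Z -> R} {f : Z -> R} {x : Z}.
Hypothesis T_norm : is_norm T.
Hypothesis T_LUR : LUR T.
Hypothesis f_lin : lin f.
Hypothesis f_le : forall z, f z <= T z.
Hypothesis Tx : T x = 1.
Hypothesis fx : f x = 1.

(** If [T v <= 1] and [f v >= 1 - d], then [T (x + v) >= 2 - d], so the LUR expression is at most
    [4 d]; otherwise the choices [d = 1/(n+1)] would produce a sequence contradicting LUR. *)
Lemma LUR_strongly_exposed (eps : R) : 0 < eps -> exists2 d : R, 0 < d &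
  forall v, T v <= 1 -> 1 - d <= f v -> T (v - x) < eps.
Proof.
move=> e0; apply: contrapT => H.
have /choice[v Hv] : forall n : nat, exists v,
    [/\ T v <= 1, 1 - n.+1%:R^-1 <= f v & eps <= T (v - x)].
  move=> n; apply: contrapT => Hn; apply: H.
  exists n.+1%:R^-1; first by rewrite invr_gt0.
  move=> v Tv fv; rewrite ltNge; apply/negP => ev.
  by apply: Hn; exists v.
have : T (v n - x) @[n --> \oo] --> 0.
  apply: (T_LUR Tx); rewrite Tx.
  have c0 : (4 * n.+1%:R^-1) @[n --> \oo] --> (0 : R).
    rewrite -(mulr0 (4 : R)); apply: cvgM; first exact: cvg_cst.
    exact: cvg_harmonic.
  apply: squeeze_cvgr (cvg_cst 0) c0; apply: nearW => n.
  have [Tv fv _] := Hv n.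
  have T0 := is_norm_ge0 T_norm (v n).
  have h1 := is_normD T_norm x (v n); rewrite Tx in h1.
  have h2 := f_le (x + v n); rewrite (linD f_lin) fx in h2.
  have d0 : (0 : R) < n.+1%:R^-1 by rewrite invr_gt0.
  have d1 : (n.+1%:R^-1 : R) <= 1 by rewrite invf_le1// ler1n.
  set d := n.+1%:R^-1 in fv d0 d1 *.
  have T1 := is_norm_ge0 T_norm (x + v n).
  by apply/andP; split; nra.
move=> /cvgrPdist_lt /(_ _ e0) [n _ /(_ n (leqnn n))] /=.
rewrite sub0r normrN ger0_norm ?is_norm_ge0//.
by have [_ _] := Hv n; rewrite leNgt => /negP.
Qed.

Lemma LUR_strongly_exposed_scaled (eps : R) : 0 < eps -> exists2 d : R, 0 < d &
  forall u (al : R), 0 <= al -> al <= 1 -> T u <= al -> al - f u <= d ->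
    T (u - al *: x) <= eps.
Proof.
move=> e0; have [d d0 H] := LUR_strongly_exposed e0.
(* For [al <= eps / 2] the triangle inequality suffices; for larger [al], dividing by [al] leaves a
   defect of at most [d]. *)
exists (d * (eps / 2)); first by rewrite !mulr_gt0// divr_gt0.
move=> u al al0 al1 Tu fu; have [ale|ale] := leP al (eps / 2).
  apply: le_trans (is_normB T_norm _ _) _.
  by rewrite is_normZ// Tx ger0_norm//; lra.
have alp : 0 < al by apply: lt_trans ale; rewrite divr_gt0.
have ia : 0 <= al^-1 by rewrite invr_ge0.
have -> : u - al *: x = al *: (al^-1 *: u - x).
  by rewrite scalerBr scalerA divff ?gt_eqF// scale1r.
rewrite is_normZ// ger0_norm//.
have /ltW h : T (al^-1 *: u - x) < eps.
  apply: H; first by rewrite is_normZ// ger0_norm// ler_pdivrMl// mulr1.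
  rewrite (linZ f_lin) ler_pdivlMl//.
  by have : d * (eps / 2) <= d * al; [rewrite ler_wpM2l// ltW|lra].
by rewrite -[leRHS]mul1r ler_pM// is_norm_ge0.
Qed.

End LUR_exposure.

(** * Small slices of the perturbed ball through a given unit vector *)

Section denting.
Context {R : realType} {X : completeNormedModType R} {T : X -> R} {e : nat -> X}.
Context {F : nat -> X -> R} {g1 : X -> R}.
Hypothesis T_equiv : equivalent_norm T.
Hypothesis T_e : forall n, (0 < n)%N -> T (e n) = 1.
Hypothesis T_smooth : forall x, x <> 0 -> smooth_at T x.
Hypothesis T_LUR : LUR T.
Hypothesis F_lin : forall n, lin (F n).
Hypothesis F_le : forall n x, (2 <= n)%N -> `|F n x| <= T x.
Hypothesis g1_lin : lin g1.
Hypothesis g1_e : forall k, (0 < k)%N -> g1 (e k) = (k == 1%N)%:R.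
Hypothesis T_split : forall x, T x ^+ 2 = T (x - g1 x *: e 1%N) ^+ 2 + g1 x ^+ 2.
Hypothesis F_total : forall w, (forall n, (2 <= n)%N -> F n w = 0) ->
  w = g1 w *: e 1%N.

Let T_norm : is_norm T := proj1 T_equiv.
Let p := norm_D T e.
Let B := weighted_form F.
Let N := perturbed_norm p B.
Let p_norm : is_norm p := norm_D_is_norm T_equiv T_e.
Let B_lin : forall y, lin (B^~ y) := weighted_form_lin F_lin F_le.
Let B_sym : forall x y, B x y = B y x := @weighted_form_sym _ _ F.
Let B_ge0 : forall x, 0 <= B x x := weighted_form_ge0 F_le.
Let N_norm : is_norm N := perturbed_is_norm p_norm B_lin B_sym B_ge0.
Let p_le_N : forall x, p x <= N x := le_perturbed_norm p_norm B_ge0.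
Let N_sqr : forall x, N x ^+ 2 = p x ^+ 2 + B x x :=
  perturbed_norm_sqr B_ge0.

Let T_ge0 := is_norm_ge0 T_norm.
Let N_ge0 := is_norm_ge0 N_norm.

Lemma perturbed_norm_le_T x : N x <= 2 * T x.
Proof.
rewrite -(ler_pXn2r (n := 2)) ?nnegrE ?mulr_ge0//.
rewrite N_sqr; have := weighted_form_le F_le x; rewrite -/B.
have := norm_D_le_T T_equiv T_e x; rewrite -/p.
have := is_norm_ge0 p_norm x; nra.
Qed.

Lemma g1_le x : `|g1 x| <= T x.
Proof.
rewrite -(ler_pXn2r (n := 2)) ?nnegrE// real_normK ?num_real//.
by rewrite T_split lerDr sqr_ge0.
Qed.

Context {x : X} {psi : X -> R}.
Hypothesis Nx : N x = 1.
Hypothesis psi_lin : lin psi.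
Hypothesis psi_le : forall y, psi y <= p y.
Hypothesis psi_x : psi x = p x.
Let r := p x.

Let x0 : x <> 0.
Proof. by move=> x0; have := oner_eq0 R; rewrite -Nx x0 is_norm0// eqxx. Qed.

Let r0 : 0 < r.
Proof. exact: (is_norm_gt0 p_norm x0). Qed.

Let psi_le_T y : psi y <= T y.
Proof. exact: le_trans (psi_le y) (norm_D_le_T T_equiv T_e y). Qed.

Let psi_abs y : `|psi y| <= 1 * T y.
Proof. by rewrite mul1r; exact: lin_le_normr. Qed.

Let c k := T_wt k * psi (e k).
Let b0 := T_op e c.

(** Test [psi] on the partial sums of [T_op e c]: the value is the sum [S] of the squares of [c],
    while the gauge is at most [sqrt S]; hence [S <= 1]. *)
Let c_l2 : l2le c 1.
Proof.
split=> // n; rewrite expr1n; set S := \sum_(1 <= k < n) c k ^+ 2.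
have S0 : 0 <= S by rewrite sumr_ge0// => k _; exact: sqr_ge0.
have : psi (T_part e c n) = S.
  rewrite /T_part lin_sum//; apply: eq_bigr => k _.
  by rewrite linZ// /c; ring.
have := psi_le (T_part e c n).
rewrite -(T_op_trunc T_equiv T_e) => /le_trans.
move=> /(_ _ (norm_D_T_op T_equiv T_e (l2le_trunc c n))) H HS.
rewrite HS -/S in H.
have := sqr_sqrtr S0; have := sqrtr_ge0 S; nra.
Qed.

(* Uniform convexity of l2: [c] represents [psi \o T] and has norm at most 1. *)
Let T_op_close a be (s : R) : l2le a be -> 0 <= s -> be - psi (T_op e a) <= s ->
  T (T_op e a - be *: b0) <= 4 * Num.sqrt (2 * be * s).
Proof.
move=> la s0 bs; have [be0 lab] := la; have [_ lc] := c_l2.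
(* Coordinatewise bounds are enough for [T_op_norm_le]. They follow from the l2 bound, where the
   squared distance is at most [2 be^2 - 2 be <c, a>]. *)
have bnd k : (0 < k)%N -> `|a k + - be * c k| <= Num.sqrt (2 * be * s).
  move=> k0; rewrite mulNr -sqrtr_sqr ler_wsqrtr//.
  apply: (@le_trans _ _ (2 * be * (be - psi (T_op e a)))); last first.
    by rewrite ler_wpM2l// mulr_ge0.
  have C : (2 * be * (be - \sum_(1 <= j < n) c j * a j)) @[n --> \oo] -->
      2 * be * (be - psi (T_op e a)).
    apply: cvgM; first exact: cvg_cst.
    apply: cvgB; first exact: cvg_cst.
    exact: (lin_T_op T_equiv T_e psi_lin psi_abs ler01 (l2le_bound la)).
  apply: ler_cvg_to (cvg_cst _) C _.
  exists k.+1 => // n /= kn.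
  apply: (@le_trans _ _ (\sum_(1 <= j < n) (a j - be * c j) ^+ 2)).
    rewrite (@big_cat_nat _ _ _ k)//=; last exact: ltnW.
    rewrite (@big_cat_nat _ _ _ k.+1 k)//= big_nat1.
    have S0 i j : 0 <= \sum_(i <= l < j) (a l - be * c l) ^+ 2.
      by rewrite sumr_ge0// => l _; exact: sqr_ge0.
    by have := S0 1%N k; have := S0 k.+1 n; lra.
  have -> : \sum_(1 <= j < n) (a j - be * c j) ^+ 2 =
    \sum_(1 <= j < n) a j ^+ 2 + be ^+ 2 * (\sum_(1 <= j < n) c j ^+ 2) -
    2 * be * \sum_(1 <= j < n) c j * a j.
    rewrite !mulr_sumr -big_split -sumrB/=; apply: eq_bigr => j _; ring.
  have := lab n; have := lc n; rewrite expr1n => h1 h2.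
  have : be ^+ 2 * (\sum_(1 <= j < n) c j ^+ 2) <= be ^+ 2.
    by rewrite ler_piMr// sqr_ge0.
  lra.
have := T_op_norm_le T_equiv T_e bnd.
rewrite (T_opD T_equiv T_e la (l2leZ (- be) c_l2)).
by rewrite (T_opZ T_equiv T_e _ c_l2) scaleNr.
Qed.

(** Half the derivative of [N^2] at [x]; it supports the unit ball of [N] at [x]. *)
Definition support_form y := r * psi y + B x y.
Let phi := support_form.

Let phi_lin : lin phi.
Proof.
move=> a y z; rewrite /phi /support_form psi_lin.
by rewrite (B_linr B_lin B_sym); ring.
Qed.

(** The left side is exactly [N x ^+ 2 + N y ^+ 2 - 2 * phi y]. Its three terms are nonnegative, so
    each is controlled by [1 - phi y]. *)
Let phi_gap y : N y <= 1 ->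
  (r - p y) ^+ 2 + 2 * r * (p y - psi y) + B (x - y) (x - y) <= 2 * (1 - phi y).
Proof.
move=> Ny; rewrite (B_B B_lin B_sym) /phi /support_form.
have := N_sqr x; have := N_sqr y; rewrite Nx -/r.
have : N y ^+ 2 <= 1 by rewrite -[leRHS](expr1n _ 2) lerXn2r// nnegrE.
lra.
Qed.

Let phi_x : phi x = 1.
Proof.
by rewrite /phi /support_form psi_x -/r -expr2 -N_sqr Nx expr1n.
Qed.

Let phi_le y : phi y <= N y.
Proof.
apply: (@le_trans _ _ (p x * p y + B x y)).
  by rewrite lerD2r ler_wpM2l// ltW.
by have := perturbed_cauchy_schwarz p_norm B_lin B_sym B_ge0 x y; rewrite -/N Nx mul1r.
Qed.

(** Comes from the constant in [T_op_close] with defect [s^2 / r] and [be <= 1]. *)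
Let K : R := 4 * Num.sqrt (2 / r).
Let K0 : 0 <= K. Proof. by rewrite mulr_ge0// sqrtr_ge0. Qed.

(** In an optimal decomposition of [y], the defect of [psi] on [y] is the sum of the nonnegative
    defects on the two parts, so both nearly attain [psi]. Writing the defect of [phi] as [s ^+ 2]
    makes the resulting distances linear in [s]. *)
Let near_face y (s : R) : N y <= 1 -> 0 <= s -> s <= 1 -> 1 - phi y <= s ^+ 2 ->
  [/\ `|p y - r| <= 2 * s, p y - psi y <= s ^+ 2 / r &
  exists u (al be : R), [/\ 0 <= al, al <= 1, T u <= al, al - psi u <= s ^+ 2 / r &
    al + be = p y /\ T (y - (u + be *: b0)) <= K * s]].
Proof.
move=> Ny s0 s1 ps; have gap := phi_gap Ny.
have Bg := B_ge0 (x - y).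
have sq := sqr_ge0 (r - p y).
have pp : 0 <= p y - psi y by rewrite subr_ge0.
have rp : 0 <= 2 * r * (p y - psi y) by rewrite !mulr_ge0// ltW.
have pgap : p y - psi y <= s ^+ 2 / r.
  by rewrite ler_pdivlMr//; nra.
split => //.
  rewrite -(ler_pXn2r (n := 2)) ?nnegrE ?mulr_ge0// real_normK ?num_real//.
  have := sqr_ge0 s; nra.
have [al [be [u [a [abp [al0 ua la yE]]]]]] := norm_D_attained T_equiv T_e y.
rewrite -/p in abp; have [be0 _] := la.
have py1 : p y <= 1 by exact: le_trans (p_le_N y) Ny.
have psiy : psi y = psi u + psi (T_op e a) by rewrite yE linD.
have pu : psi u <= al by exact: le_trans (psi_le_T u) ua.
have pa : psi (T_op e a) <= be.
  exact: le_trans (psi_le _) (norm_D_T_op T_equiv T_e la).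
exists u, al, be; split => //; [lra|lra|split => //].
have -> : y - (u + be *: b0) = T_op e a - be *: b0.
  by rewrite yE opprD addrACA subrr add0r.
have s2 : 0 <= s ^+ 2 / r by rewrite divr_ge0 ?sqr_ge0// ltW.
have bs : be - psi (T_op e a) <= s ^+ 2 / r by lra.
apply: le_trans (T_op_close la s2 bs) _.
have sE : s = Num.sqrt (s ^+ 2) by rewrite sqrtr_sqr ger0_norm.
rewrite /K -[leRHS]mulrA ler_wpM2l// [in leRHS]sE -sqrtrM; last first.
  by rewrite divr_ge0// ltW.
rewrite ler_wsqrtr//.
have -> : 2 / r * s ^+ 2 = 2 * (s ^+ 2 / r) by ring.
rewrite -[leLHS]mulrA ler_wpM2l// ler_piMl//; lra.
Qed.

(** A slice given by functional and level; [M] records the boundedness needed to make [h] an element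
    of [dual N]. *)
Definition slice_separated (eps : R) := exists h : X -> R, exists M d : R,
  [/\ lin h, forall y, `|h y| <= M * N y, d < h x &
  forall y, N y <= 1 -> eps <= N (y - x) -> h y <= d].

(** Near the face, [y] is close to [al *: u1 + be *: b0] with [al + be] close to [r], so [y - x] is
    nearly a multiple of [w = u1 - b0]. A controlled functional not vanishing at [w] bounds the
    coefficient, and [phi] itself cuts out the slice. *)
Lemma denting_exposed (eps al0 be0 : R) u0 : 0 < eps -> 0 < al0 ->
  T u0 = al0 -> psi u0 = al0 -> x = u0 + be0 *: b0 -> al0 + be0 = r ->
  slice_separated eps.
Proof.
move=> eps0 al00 Tu0 pu0 xE abr.
pose u1 := al0^-1 *: u0.
have u0E : u0 = al0 *: u1 by rewrite scalerA divff ?gt_eqF// scale1r.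
have ia : 0 <= al0^-1 by rewrite invr_ge0 ltW.
have Tu1 : T u1 = 1 by rewrite is_normZ// ger0_norm// Tu0 mulVf// gt_eqF.
have pu1 : psi u1 = 1 by rewrite linZ// pu0 mulVf// gt_eqF.
pose w := u1 - b0.
(* A segment through [x] in the face cannot be parallel to [e 1], because
   [psi (e 1) = 0] forces [g1 b0 = 0] and then [T u1 > T b0 >= 1]. *)
have [C [C0 HC]] : exists C : R, 0 <= C /\ forall y (s t : R) E, N y <= 1 -> 0 <= s ->
    s <= 1 -> 1 - phi y <= s ^+ 2 -> y - x = t *: w + E ->
    `|t| * T w <= C * (s + T E).
  have [w0|/eqP w0] := eqVneq w 0.
    exists 0; split=> // y s t E _ s0 _ _ _.
    by rewrite w0 is_norm0// mulr0 mul0r.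
  (* Evaluating [h] on [y - x = t *: w + E] recovers [t] up to an error of order [s + T E]. *)
  suff [h [L [hl hT hw hL]]] : exists h (L : R), [/\ lin h, forall z, `|h z| <= T z,
      h w <> 0 & forall y (s : R), N y <= 1 -> 0 <= s -> s <= 1 -> 1 - phi y <= s ^+ 2 ->
      `|h (y - x)| <= L * s].
    have hw0 : 0 < `|h w| by rewrite normr_gt0; apply/eqP.
    exists (T w / `|h w| * Num.max `|L| 1); split.
      rewrite !mulr_ge0 ?T_ge0 ?invr_ge0// le_max ler01 orbT//.
    move=> y s t E Ny s0 s1 ps yE.
    have := hL y s Ny s0 s1 ps; rewrite yE linD// linZ// => H.
    have tE : `|t| * `|h w| <= L * s + T E.
      rewrite -normrM; apply: le_trans (lerD H (hT E)).
      have := ler_normB (t * h w + h E) (h E); rewrite addrK.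
      by move=> /le_trans; apply.
    have -> : `|t| * T w = T w / `|h w| * (`|t| * `|h w|).
      by field; rewrite gt_eqF.
    rewrite -[leRHS]mulrA ler_wpM2l ?divr_ge0//.
    apply: le_trans tE _; rewrite mulrDr lerD//.
      by rewrite ler_wpM2r// le_max ler_norm.
    by rewrite ler_peMl// le_max lexx orbT.
  have [psiw|psiw] := eqVneq (psi w) 0; last first.
    exists psi, (2 + r^-1); split => //; last 1 first.
    - move=> y s Ny s0 s1 ps; have [h1 h2 _] := near_face Ny s0 s1 ps.
      rewrite linB// psi_x -/r.
      have -> : psi y - r = (p y - r) - (p y - psi y) by ring.
      apply: le_trans (ler_normB _ _) _; rewrite mulrDl lerD//.
      rewrite ger0_norm ?subr_ge0//; apply: le_trans h2 _.
      by rewrite mulrC ler_wpM2l ?invr_ge0 ?(ltW r0)//; nra.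
    - exact: lin_le_normr.
    - exact/eqP.
  have [[n [n2 Fw]]|noF] := pselect (exists n, (2 <= n)%N /\ F n w <> 0).
    (* The constant inverts the weight in [2^-n F_n(x-y)^2 <= B (x-y) (x-y) <= 2 s^2]. *)
    exists (F n), (Num.sqrt (2 * 2 ^+ n)); split => //; first by move=> z; exact: F_le.
    move=> y s Ny s0 s1 ps; have gap := phi_gap Ny.
    have Ft := weighted_form_term F_le (x - y) n2; rewrite -/B in Ft.
    have sq := sqr_ge0 (r - p y).
    have rp : 0 <= 2 * r * (p y - psi y).
      by rewrite !mulr_ge0 ?(ltW r0)// subr_ge0.
    have n0 : (0 : R) < 2 ^+ n by rewrite exprn_gt0.
    have sE : s = Num.sqrt (s ^+ 2) by rewrite sqrtr_sqr ger0_norm.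
    rewrite [in leRHS]sE -sqrtrM ?mulr_ge0 ?(ltW n0)//.
    rewrite -[leLHS]sqrtr_sqr ler_wsqrtr//.
    rewrite -(opprB x y) linN// sqrrN.
    have -> : F n (x - y) ^+ 2 = 2 ^+ n * (2 ^- n * F n (x - y) ^+ 2).
      by rewrite mulrA mulfV ?mul1r// gt_eqF.
    rewrite [2 * _]mulrC -[leRHS]mulrA ler_wpM2l ?(ltW n0)//.
    lra.
  exfalso.
  have wE : w = g1 w *: e 1%N.
    by apply: F_total => n n2; apply: contrapT => Fw; apply: noF; exists n.
  have gw : g1 w <> 0 by move=> g0; apply: w0; rewrite wE g0 scale0r.
  have pe1 : psi (e 1%N) = 0.
    move: psiw; rewrite wE linZ// => /eqP; rewrite mulf_eq0 => /orP[/eqP//|/eqP//].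
  have g1b0 : g1 b0 = 0.
    have g1_abs z : `|g1 z| <= 1 * T z by rewrite mul1r g1_le.
    rewrite (T_op_coordinate T_equiv T_e g1_lin g1_abs ler01 (l2le_bound c_l2) _ g1_e)//.
    by rewrite /c pe1 !mulr0.
  have g1u1 : g1 u1 = g1 w by rewrite [in RHS]/w linB// g1b0 subr0.
  have := T_split u1; rewrite g1u1 -wE Tu1 expr1n.
  have -> : u1 - w = b0 by rewrite /w opprB addrC subrK.
  have : 1 <= T b0.
    apply: le_trans (psi_le_T b0).
    by move: psiw; rewrite /w linB// pu1 => /eqP; rewrite subr_eq0 => /eqP <-.
  have : 0 < g1 w ^+ 2 by rewrite exprn_even_gt0//=; apply/eqP.
  nra.
have [d d0 Hd] : exists2 d : R, 0 < d &
    forall y, N y <= 1 -> 1 - d <= phi y -> N (y - x) < eps.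
  (* The final estimate is [N (y - x) <= 2 T (y - x) <= 2 (C + 1) (s + T E)], with [s + T E <= 2 D],
     hence at most [eps / 2]. *)
  pose D := eps / (8 * (C + 1)).
  have C1 : 0 < 8 * (C + 1) by lra.
  have D0 : 0 < D by rewrite divr_gt0.
  have [d d0 Hd] := LUR_strongly_exposed_scaled T_norm T_LUR psi_lin psi_le_T Tu1 pu1 D0.
  pose K1 : R := 1 + K + 2 * T b0.
  have K10 : 0 < K1 by rewrite /K1 -addrA ltr_pwDl// addr_ge0// mulr_ge0.
  pose s := Num.min 1 (Num.min (d * r) (D / K1)).
  have s0 : 0 < s by rewrite !lt_min ltr01 mulr_gt0//= divr_gt0.
  have s1 : s <= 1 by rewrite ge_min lexx.
  have sd : s <= d * r by rewrite !ge_min lexx !orbT.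
  have sK : s * K1 <= D by rewrite -ler_pdivlMr// !ge_min lexx !orbT.
  exists (s ^+ 2); first by rewrite exprn_gt0.
  move=> y Ny py; have ps : 1 - phi y <= s ^+ 2 by lra.
  have [h1 _ [u [al [be [al_0 al_1 Tu pu [abp Hy]]]]]] := near_face Ny (ltW s0) s1 ps.
  have du : al - psi u <= d.
    apply: le_trans pu _; rewrite ler_pdivrMr//; nra.
  have Hu := Hd u al al_0 al_1 Tu du.
  (* The errors are the deviation of the l2 part from [be *: b0], that of [u] from [al *: u1], and
     the change of the gauge. *)
  pose E := (y - (u + be *: b0)) + (u - al *: u1) + (p y - r) *: b0.
  have yE : y - x = (al - al0) *: w + E.
    rewrite /E; have -> : u - al *: u1 = (u + be *: b0) - (al *: u1 + be *: b0).
      by rewrite opprD addrACA subrr addr0.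
    rewrite subrKA addrCA -[LHS](subrKA (al *: u1 + be *: b0)).
    congr (_ + _); rewrite /w scalerBr -[RHS]addrA -scaleNr -scalerDl.
    have -> : - (al - al0) + (p y - r) = be - be0 by rewrite -abp -abr; ring.
    by rewrite !scalerBl addrACA -opprD -u0E -xE.
  have TE : T E <= K * s + D + 2 * s * T b0.
    apply: le_trans (is_normD T_norm _ _) _; apply: lerD.
      exact: le_trans (is_normD T_norm _ _) (lerD Hy Hu).
    by rewrite is_normZ// ler_wpM2r.
  have Ht := HC y s _ _ Ny (ltW s0) s1 ps yE.
  apply: le_lt_trans (perturbed_norm_le_T _) _.
  have TyE : T (y - x) <= `|al - al0| * T w + T E.
    by rewrite yE; apply: le_trans (is_normD T_norm _ _) _; rewrite is_normZ.
  have : (C + 1) * (s + T E) <= (C + 1) * (2 * D).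
    rewrite ler_wpM2l ?addr_ge0//; rewrite /K1 in sK; nra.
  have : (C + 1) * (2 * D) = eps / 4.
    by rewrite /D; field; rewrite gt_eqF//; lra.
  lra.
exists phi, 1, (1 - d); split => //.
- by move=> y; rewrite mul1r; exact: lin_le_normr.
- by rewrite phi_x; lra.
- move=> y Ny ey; rewrite leNgt; apply/negP => /ltW /(Hd y Ny).
  by rewrite ltNge ey.
Qed.

(** On a near-face point the support functional [th] of [T] at [b0] counts the l2 part with factor
    [tau > 1] but the [T]-part only with factor 1. A [T]-part of size [al] thus costs
    [al * (tau - 1)], and points far from [x] have [al] bounded below. *)
Lemma denting_averaged (eps : R) : 0 < eps -> x = r *: b0 -> 1 < T b0 ->
  slice_separated eps.
Proof.
move=> eps0 xE; set tau := T b0 => tau1.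
have b00 : b0 <> 0 by move=> b00; move: tau1; rewrite /tau b00 is_norm0// ltr10.
have [th [thl thle thb]] := smooth_support T_norm (T_smooth b00).
rewrite -/tau in thb.
have thx : th x = r * tau by rewrite xE (linZ thl) thb.
(* Distance [eps] from [x] forces [al * (1 + tau) >= eps / 4], a loss of [2 * kap] in [th]; one
   [kap] absorbs the errors of order [s]. *)
pose kap := eps * (tau - 1) / (8 * (1 + tau)).
have kap0 : 0 < kap by rewrite divr_gt0 ?mulr_gt0// ?subr_gt0//; lra.
pose m := Num.min (eps / 4) kap.
have m0 : 0 < m by rewrite lt_min kap0 divr_gt0.
have m1 : m <= eps / 4 by rewrite ge_min lexx.
have m2 : m <= kap by rewrite ge_min lexx orbT.
pose K1 := 2 * tau + K.
have K10 : 0 < K1 by rewrite /K1 ltr_wpDr// mulr_gt0//; lra.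
pose s := Num.min 1 (m / K1).
have s0 : 0 < s by rewrite lt_min ltr01 divr_gt0.
have s1 : s <= 1 by rewrite ge_min lexx.
have sK : s * K1 <= m by rewrite -ler_pdivlMr// ge_min lexx orbT.
have face y : N y <= 1 -> 1 - phi y <= s ^+ 2 -> eps <= N (y - x) ->
    th y <= th x - kap.
  move=> Ny ps ey; have [h1 _ [u [al [be [al_0 al_1 Tu pu [abp Hy]]]]]] :=
    near_face Ny (ltW s0) s1 ps.
  pose E := y - (u + be *: b0).
  have yE : y = u + be *: b0 + E by rewrite /E subrKC.
  have {}Hy : T E <= K * s by [].
  clearbody E; have thE : th E <= K * s := le_trans (thle E) Hy.
  have h2 : th y <= al + be * tau + K * s.
    have thu := le_trans (thle u) Tu.
    rewrite yE !(linD thl) (linZ thl) thb; exact: lerD (lerD thu (lexx _)) thE.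
  have /andP[h3 h4] : - (2 * s) <= p y - r <= 2 * s by rewrite -ler_norml.
  have h5 : T (y - x) <= al + `|be - r| * tau + K * s.
    have -> : y - x = u + (be - r) *: b0 + E.
      by rewrite yE scalerBl -xE addrA [RHS]addrAC.
    apply: le_trans (is_normD T_norm _ _) (lerD _ Hy).
    apply: le_trans (is_normD T_norm _ _) (lerD Tu _).
    by rewrite is_normZ.
  have h6 : `|be - r| <= al + 2 * s.
    by rewrite ler_norml; lra.
  have h7 : `|be - r| * tau <= (al + 2 * s) * tau.
    by rewrite ler_wpM2r//; lra.
  have h8 : eps / 2 <= T (y - x) by have := perturbed_norm_le_T (y - x); lra.
  have h9 : eps / 4 <= al * (1 + tau) by rewrite /K1 in sK; nra.
  have h10 : 2 * kap <= al * (tau - 1).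
    have -> : 2 * kap = (eps / 4) * ((tau - 1) / (1 + tau)).
      by rewrite /kap; field; rewrite gt_eqF//; lra.
    apply: (@le_trans _ _ (al * (1 + tau) * ((tau - 1) / (1 + tau)))).
      by rewrite ler_wpM2r// divr_ge0//; lra.
    rewrite le_eqVlt; apply/orP; left; apply/eqP.
    by field; rewrite gt_eqF//; lra.
  have h11 : p y * tau <= (r + 2 * s) * tau by rewrite ler_wpM2r//; lra.
  rewrite thx; rewrite /K1 in sK; rewrite -abp in h11.
  lra.
have th4 y : `|th y| <= 4 * N y.
  apply: le_trans (lin_le_normr thl T_norm thle y) _.
  by apply: le_trans (T_le_norm_D T_equiv T_e y) _; rewrite ler_wpM2l.
(* Away from the face [phi] drops by more than [s ^+ 2], so [C * phi] drops by at least [4 + kap],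
   which outweighs [th y <= 4] against [th x >= 0]. *)
pose C := (4 + kap) / s ^+ 2.
have s20 : 0 < s ^+ 2 by rewrite exprn_gt0.
have C0 : 0 < C by rewrite divr_gt0// addr_gt0.
have Cs : C * s ^+ 2 = 4 + kap by rewrite divfK// gt_eqF.
exists (fun y => 1 * th y + C * phi y), (4 + C), (th x + C - kap); split.
- exact: lin_comb.
- move=> y; rewrite mul1r; apply: le_trans (ler_normD _ _) _.
  rewrite mulrDl lerD// normrM gtr0_norm// ler_wpM2l// ?(ltW C0)//.
  exact: lin_le_normr.
- by rewrite mul1r phi_x; lra.
move=> y Ny ey; rewrite mul1r; have [ps|ps] := leP (1 - phi y) (s ^+ 2).
  have := face y Ny ps ey.
  have : C * phi y <= C by rewrite ger_pMr// (le_trans (phi_le y)).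
  lra.
have : C * phi y <= C - (4 + kap).
  by rewrite -Cs -[X in X - _]mulr1 -mulrBr ler_wpM2l ?(ltW C0)//; lra.
have : th y <= 4.
  apply: le_trans (ler_norm _) _; apply: le_trans (th4 y) _; lra.
have : 0 <= th x by rewrite thx mulr_ge0 ?(ltW r0)//; lra.
lra.
Qed.

Lemma slice_separated_all (eps : R) : 0 < eps -> slice_separated eps.
Proof.
move=> eps0.
have [al0 [be0 [u0 [a0 [abp [al00 ua la xE]]]]]] := norm_D_attained T_equiv T_e x.
rewrite -/p -/r in abp; have [be00 _] := la.
have psix : psi u0 + psi (T_op e a0) = r by rewrite -(linD psi_lin) -xE.
have h1 : psi u0 <= al0 := le_trans (psi_le_T u0) ua.
have h2 : psi (T_op e a0) <= be0.
  exact: le_trans (psi_le _) (norm_D_T_op T_equiv T_e la).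
(* Both parts of the optimal decomposition of [x] attain [psi], so [T_op_close] applies with defect
   zero. *)
have aE : T_op e a0 = be0 *: b0.
  apply/eqP; rewrite -subr_eq0; apply/eqP/(is_norm_eq0 T_norm)/eqP.
  rewrite eq_le T_ge0 andbT.
  have bs : be0 - psi (T_op e a0) <= 0 by lra.
  by have := T_op_close la (lexx 0) bs; rewrite mulr0 sqrtr0 mulr0.
rewrite aE in xE.
have [al01|al01] := ltP 0 al0.
  have pu0 : psi u0 = al0 by lra.
  apply: (denting_exposed eps0 al01 _ pu0 xE abp).
  by apply/eqP; rewrite eq_le ua -{1}pu0 psi_le_T.
have al0E : al0 = 0 by apply/eqP; rewrite eq_le al01.
have u00 : u0 = 0.
  by apply: (is_norm_eq0 T_norm); apply/eqP; rewrite eq_le T_ge0 andbT -al0E.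
have be0E : be0 = r by rewrite -abp al0E add0r.
have {}xE : x = r *: b0 by rewrite xE u00 add0r be0E.
have [Tb|Tb] := leP (T b0) 1; last exact: denting_averaged.
have psib : psi b0 = 1.
  have := psi_x; rewrite xE (linZ psi_lin) -/p -xE -/r => H.
  by apply: (mulfI (lt0r_neq0 r0)); rewrite mulr1.
have Tb1 : T b0 = 1 by apply/eqP; rewrite eq_le Tb -{1}psib psi_le_T.
(* When [T b0 = 1], the vector [x] itself serves as the [T]-part, with no l2 part. *)
apply: (@denting_exposed _ r 0 x) => //; last by rewrite addr0.
- by rewrite xE is_normZ// Tb1 mulr1 gtr0_norm.
- by rewrite scale0r addr0.
Qed.

End denting.

(** * ALUR norms and their duals *)

Section dual_functionals.
Context {R : realType} {Z : lmodType R} {N : Z -> R}.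

Lemma bounded_functionalP (f : Z -> R) : f \in bounded_functional N <->
  lin f /\ exists M, forall x, `|f x| <= M * N x.
Proof. by split=> [/asboolP[]|[fl fM]]; [|apply/asboolP; split]. Qed.

Lemma dual_lin (f : dual N) : lin f.
Proof. by have /bounded_functionalP[] := dual_funP f. Qed.

Lemma dual_bounded (f : dual N) : exists M, forall x, `|f x| <= M * N x.
Proof. by have /bounded_functionalP[] := dual_funP f. Qed.

Lemma lin_dual (f : Z -> R) M : lin f -> (forall x, `|f x| <= M * N x) ->
  exists F : dual N, dual_fun F = f.
Proof.
move=> fl fM; have fP : f \in bounded_functional N.
  by apply/bounded_functionalP; split => //; exists M.
by exists (Dual fP).
Qed.

Lemma dualDZE (f g : dual N) (a : R) x : (f + a *: g) x = f x + a * g x.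
Proof. by []. Qed.

Lemma dualBZE (f g : dual N) (a : R) x : (f - a *: g) x = f x - a * g x.
Proof. by []. Qed.

End dual_functionals.

Section ALUR_theory.
Context {R : realType} {Z : lmodType R} {N : Z -> R}.
Hypothesis N_norm : is_norm N.
Let N_ge0 := is_norm_ge0 N_norm.

Lemma separated_ALUR :
  (forall x, N x = 1 -> forall eps : R, 0 < eps ->
    exists h : Z -> R, exists M d : R,
    [/\ lin h, forall y, `|h y| <= M * N y, d < h x &
    forall y, N y <= 1 -> eps <= N (y - x) -> h y <= d]) -> ALUR N.
Proof.
move=> H x Nx V [r r0 rV].
(* The cap 1 keeps [- x], at distance 2 from [x], outside the slice, which shows that the functional
   is nonzero. *)
have e0 : 0 < Num.min r 1 by rewrite lt_min r0 ltr01.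
have [h [M [d [hl hM dx Hd]]]] := H x Nx _ e0.
have [f fE] := lin_dual hl hM.
have ub : has_ubound (f @` closed_unit_ball N).
  exists `|M| => _ [y Ny <-]; rewrite fE; apply: le_trans (ler_norm _) _.
  apply: le_trans (hM y) _; apply: (@le_trans _ _ (`|M| * N y)).
    by rewrite ler_wpM2r// ler_norm.
  by rewrite ler_piMr.
have xs : h x <= sup (f @` closed_unit_ball N).
  by apply: ub_le_sup => //; exists x; rewrite ?fE// /closed_unit_ball/= Nx.
have ad : sup (f @` closed_unit_ball N) - (sup (f @` closed_unit_ball N) - d) = d.
  by rewrite subKr.
exists [set y | closed_unit_ball N y /\ d < h y]; split.
- exists f, (sup (f @` closed_unit_ball N) - d); split => //.
  + move=> f0; have h0 y : h y = 0 by rewrite -fE f0.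
    have /(_ _)/= := Hd (- x); rewrite is_normN// Nx => /(_ (lexx 1)).
    have -> : N (- x - x) = 2.
      rewrite -opprD (is_normN N_norm) -mulr2n -scaler_nat (is_normZ N_norm).
      by rewrite Nx mulr1 normr_nat.
    rewrite ge_min (_ : 1 <= 2) ?orbT ?ler1n// => /(_ isT).
    by rewrite h0 leNgt; move: dx; rewrite h0 => ->.
  + by rewrite subr_gt0 (lt_le_trans dx).
  + by apply/seteqP; split=> y /=; rewrite ad fE.
- by split; rewrite // /closed_unit_ball/= Nx.
- move=> y [Ny dy]; apply: rV => /=; rewrite ltNge; apply/negP => ry.
  have := Hd y Ny; rewrite ge_min ry => /(_ isT).
  by rewrite leNgt dy.
Qed.

Hypothesis N_ALUR : ALUR N.

Lemma ALUR_slice x (eps : R) : N x = 1 -> 0 < eps ->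
  exists (h : dual N) (d : R), d < h x /\
    forall y, N y <= 1 -> d < h y -> N (y - x) < eps.
Proof.
move=> Nx e0.
have [|S [[f [al [_ _ _ ->]]] [_ Sx] SV]] := N_ALUR Nx (V := [set y | N (y - x) < eps]).
  by exists eps.
by exists f; eexists; split; [exact: Sx|move=> y Ny fy; exact: SV].
Qed.

(** The midpoint has norm 1, and any slice containing it contains [x] or [z]. A slice of radius
    below half their distance around the midpoint is then impossible. *)
Lemma ALUR_rotund (f : Z -> R) x z : lin f -> (forall y, f y <= N y) ->
  N x <= 1 -> N z <= 1 -> f x = 1 -> f z = 1 -> x = z.
Proof.
move=> fl fN Nx Nz fx fz; apply/eqP; rewrite -subr_eq0; apply/negPn/negP => xz.
have xz0 : 0 < N (x - z) by apply: is_norm_gt0 => //; apply/eqP.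
pose m := 2^-1 *: (x + z).
have Nm : N m = 1.
  apply/eqP; rewrite eq_le; apply/andP; split.
    rewrite is_normZ// gtr0_norm ?invr_gt0//.
    have := is_normD N_norm x z; lra.
  have := fN m; rewrite (linZ fl) (linD fl) fx fz; lra.
have [|h [d [dm H]]] := @ALUR_slice m (N (x - z) / 2) Nm.
  by rewrite divr_gt0.
have hl := dual_lin h.
have xm : x - m = 2^-1 *: (x - z).
  rewrite /m scalerDr scalerBr opprD addrA; congr (_ - _).
  by rewrite -[x in x - _]scale1r -scalerBl; congr (_ *: _); field.
have zm : z - m = 2^-1 *: (z - x).
  rewrite /m scalerDr scalerBr opprD addrCA addrC; congr (_ - _).
  by rewrite -[z in z - _]scale1r -scalerBl; congr (_ *: _); field.
have : d < h x \/ d < h z.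
  have := dm; rewrite /m (linZ hl) (linD hl) => dm'.
  by have [|hx] := ltP d (h x); [left|right; lra].
case=> [/(H _ Nx)|/(H _ Nz)].
  by rewrite xm is_normZ// gtr0_norm ?invr_gt0// mulrC ltxx.
by rewrite zm is_normZ// gtr0_norm ?invr_gt0// mulrC (is_norm_distC N_norm) ltxx.
Qed.

Context {U : set_system nat}.
Hypothesis U_proper : ProperFilter U.
Hypothesis U_oo : \oo `<=` U.
Hypothesis N_weak : forall y : nat -> Z, (forall n, N (y n) <= 1) ->
  exists z, N z <= 1 /\ forall f : dual N, f (y n) @[n --> U] --> f z.

(** Weak limits of maximizing sequences lie in the face of [f], a single point [x] by rotundity. A
    small slice at [x] then contains members of any such sequence, so none can stay away from [x] in
    norm. *)
Lemma ALUR_strongly_exposed (f : dual N) : dual_norm N f = 1 ->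
  forall eps : R, 0 < eps -> exists2 d : R, 0 < d &
  forall y z, N y <= 1 -> N z <= 1 -> 1 - d < f y -> 1 - d < f z ->
    N (y - z) < eps.
Proof.
move=> f1; have fl := dual_lin f; have [M fM] := dual_bounded f.
have fN y : f y <= N y.
  apply: le_trans (ler_norm _) _.
  by have := le_dual_norm N_norm fl fM y; rewrite f1 mul1r.
have lim1 v z : (forall n, N (v n) <= 1 /\ 1 - n.+1%:R^-1 < f (v n)) -> N z <= 1 ->
    f (v n) @[n --> U] --> f z -> f z = 1.
  move=> Hv Nz cz; apply/eqP; rewrite eq_le (le_trans (fN z))//=.
  have c1 : (1 - n.+1%:R^-1) @[n --> U] --> (1 - 0 : R).
    apply: cvgB; first exact: cvg_cst.
    by apply: cvg_trans (cvg_harmonic (R := R)); apply: cvg_app.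
  rewrite -[leLHS]subr0; apply: ler_cvg_to c1 cz _.
  by apply: nearW => n; have [_ /ltW] := Hv n.
have i0 n : (0 : R) < n.+1%:R^-1 by rewrite invr_gt0.
have /choice[v Hv] : forall n : nat, exists v, N v <= 1 /\ 1 - n.+1%:R^-1 < f v.
  move=> n; have [v Nv fv] := dual_norm_approx N_norm fl fM (i0 n).
  by exists v; rewrite f1 in fv.
have [x [Nx cx]] := N_weak (fun n => (Hv n).1).
have fx := lim1 v x Hv Nx (cx f).
have Nx1 : N x = 1 by apply/eqP; rewrite eq_le Nx -fx fN.
suff expo : forall eps : R, 0 < eps -> exists2 d : R, 0 < d &
    forall y, N y <= 1 -> 1 - d < f y -> N (y - x) < eps.
  move=> eps e0; have [|d d0 H] := expo (eps / 2); first by rewrite divr_gt0.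
  exists d => // y z Ny Nz fy fz; have h1 := H y Ny fy; have h2 := H z Nz fz.
  have := is_normB N_norm (y - x) (z - x); rewrite opprB addrA subrK; lra.
move=> eps e0; apply: contrapT => Hn.
have /choice[w Hw] : forall n : nat, exists w,
    (N w <= 1 /\ 1 - n.+1%:R^-1 < f w) /\ eps <= N (w - x).
  move=> n; apply: contrapT => Hw; apply: Hn; exists n.+1%:R^-1 => // y Ny fy.
  by rewrite ltNge; apply/negP => ey; apply: Hw; exists y.
have [z [Nz cz]] := N_weak (fun n => (Hw n).1.1).
have fz := lim1 w z (fun n => (Hw n).1) Nz (cz f).
have zx : z = x by apply: (ALUR_rotund fl fN).
have [h [d [dh H]]] := ALUR_slice Nx1 e0.
have : \forall n \near U, d < h (w n) by apply: (cvgr_gt _ (cz h)); rewrite zx.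
move=> /filter_ex [n dn].
by have := H _ (Hw n).1.1 dn; rewrite ltNge (Hw n).2.
Qed.

(** Smulyan's argument: near-maximizers [y] of [f + h *: g] and [z] of [f - h *: g] lie in one small
    slice of [f], so the second difference is at most [h * (g y - g z)] plus small errors, uniformly
    in [g]. *)
Lemma ALUR_dual_frechet : frechet_smooth (fun f : dual N => dual_norm N f).
Proof.
move=> f f1 eps e0.
have e8 : 0 < eps / 8 by rewrite divr_gt0.
have [d d0 Hd] := ALUR_strongly_exposed f1 e8.
have fl := dual_lin f; have [M fM] := dual_bounded f.
(* Near-maximizers lose at most [2 |h| + 2 eta <= 4 |h|] in [f], which stays below [d]. *)
pose k := Num.min (d / 8) 1.
have k0 : 0 < k by rewrite lt_min ltr01 divr_gt0.
exists k => //= h /=; rewrite sub0r normrN lt_min => /andP[hd h1] h0 g g1.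
have gl := dual_lin g; have [Mg gM] := dual_bounded g.
have gN y : `|g y| <= N y.
  by have := le_dual_norm N_norm gl gM y; rewrite g1 mul1r.
have hp : 0 < `|h| by rewrite normr_gt0.
have near (F : dual N) (t : R) : `|t| = `|h| -> (forall y, F y = f y + t * g y) ->
    forall eta : R, 0 < eta -> eta <= `|h| ->
    1 - `|h| - eta <= dual_norm N F /\
    exists y, [/\ N y <= 1, dual_norm N F - eta < f y + t * g y & 1 - d < f y].
  move=> th FE eta eta0 etah; have Fl := dual_lin F; have [MF FM] := dual_bounded F.
  have tg y : N y <= 1 -> `|t * g y| <= `|h|.
    by move=> Ny; rewrite normrM th ler_piMr// (le_trans (gN y)).
  have F1 : 1 - `|h| - eta <= dual_norm N F.
    have [y Ny fy] := dual_norm_approx N_norm fl fM eta0; rewrite f1 in fy.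
    have := le_trans (ler_norm _) (ball_le_dual_norm N_norm FM Ny).
    rewrite FE; have := tg y Ny; rewrite ler_norml => /andP[]; lra.
  split=> //.
  have [y Ny Fy] := dual_norm_approx N_norm Fl FM eta0; rewrite FE in Fy.
  exists y; split => //; have := tg y Ny; rewrite ler_norml => /andP[h2 h3].
  lra.
have eta0 : 0 < Num.min `|h| (`|h| * eps / 8) by rewrite lt_min hp divr_gt0 ?mulr_gt0.
have etah : Num.min `|h| (`|h| * eps / 8) <= `|h| by rewrite ge_min lexx.
have etae : Num.min `|h| (`|h| * eps / 8) <= `|h| * eps / 8 by rewrite ge_min lexx orbT.
set eta := Num.min _ _ in eta0 etah etae.
have NhE : `|- h| = `|h| by rewrite normrN.
have [_ [y [Ny Fy fy]]] := near (f + h *: g) h erefl (fun y => dualDZE f g h y) eta eta0 etah.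
have [|_ [z [Nz Fz fz]]] := near (f - h *: g) (- h) NhE _ eta eta0 etah.
  by move=> u; rewrite dualBZE mulNr.
have yz := Hd y z Ny Nz fy fz.
have fN u : N u <= 1 -> f u <= 1.
  move=> Nu; apply: le_trans (ler_norm _) _.
  by apply: le_trans (le_dual_norm N_norm fl fM u) _; rewrite f1 mul1r.
have up : dual_norm N (f + h *: g) + dual_norm N (f - h *: g) - 2 <= `|h| * (eps / 2).
  have gyz : h * (g y - g z) <= `|h| * (eps / 8).
    apply: le_trans (ler_norm _) _; rewrite normrM ler_wpM2l//.
    by rewrite -(linB gl) (le_trans (gN _))// ltW.
  have := fN y Ny; have := fN z Nz; lra.
have low : 0 <= dual_norm N (f + h *: g) + dual_norm N (f - h *: g) - 2.
  rewrite leNgt; apply/negP => neg.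
  have c0 : 0 < (2 - (dual_norm N (f + h *: g) + dual_norm N (f - h *: g))) / 2 by lra.
  have [u Nu fu] := dual_norm_approx N_norm fl fM c0; rewrite f1 in fu.
  have q (F : dual N) : F u <= dual_norm N F.
    have [MF FM] := dual_bounded F.
    exact: le_trans (ler_norm _) (ball_le_dual_norm N_norm FM Nu).
  have := q (f + h *: g); have := q (f - h *: g); rewrite dualDZE dualBZE; lra.
rewrite normrM normfV (ger0_norm low) ltr_pdivrMr//.
by apply: le_lt_trans up _; rewrite mulrC ltr_pM2r//; lra.
Qed.

End ALUR_theory.

(** The limits of [f (y n)] along [U] define a bounded functional on the dual, represented by some
    [z]. Reflexivity concerns the original norm, so functionals of [dual N] are transferred by
    equivalence; a support functional of [N] at [z] gives [N z <= 1]. *)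
Lemma reflexive_weak_limit (R : realType) (X : completeNormedModType R) (N : X -> R)
    (U : set_system nat) :
  equivalent_norm N -> (forall x, x <> 0 -> smooth_at N x) ->
  ProperFilter U ->
  (forall (u : nat -> R) (M : R), (forall n, `|u n| <= M) ->
    exists l : R, u @ U --> l) ->
  reflexive_space (@Num.norm R X) ->
  forall y : nat -> X, (forall n, N (y n) <= 1) ->
  exists z, N z <= 1 /\ forall f : dual N, f (y n) @[n --> U] --> f z.
Proof.
move=> N_equiv N_smooth UP Ulim refl y Ny.
have N_norm := proj1 N_equiv; have [K K0 HK] := norm_equiv_bound N_equiv.
have X_norm : is_norm (@Num.norm R X).
  by split; [exact: ler_normD|exact: normrZ|exact: normr0_eq0].
pose phi (f : dual (@Num.norm R X)) : R := lim (f (y n) @[n --> U]).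
have yK n : `|y n| <= K by apply: le_trans (HK _).1 _; rewrite ger_pMr.
have fy (f : dual (@Num.norm R X)) n : `|f (y n)| <= K * dual_norm (@Num.norm R X) f.
  have [M fM] := dual_bounded f.
  apply: le_trans (le_dual_norm X_norm (dual_lin f) fM _) _.
  by rewrite mulrC ler_wpM2r//; exact: (dual_norm_ge0 X_norm fM).
have cphi (f : dual (@Num.norm R X)) : f (y n) @[n --> U] --> phi f.
  by have [l Hl] := Ulim _ _ (fy f); apply/cvg_ex; exists l.
have phil : lin phi.
  move=> a f g; apply: cvg_lim => //.
  have -> : (fun n => (a *: f + g) (y n)) = (fun n => a * f (y n) + g (y n)) by [].
  by apply: cvgD; [apply: cvgM; [exact: cvg_cst|]|]; exact: cphi.
have phiK (f : dual (@Num.norm R X)) : `|phi f| <= K * dual_norm (@Num.norm R X) f.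
  apply: (ler_cvg_to (cvg_norm (cphi f)) (cvg_cst _)).
  by apply: nearW => n; exact: fy.
have [PHI PHIE] := lin_dual phil phiK.
have [z Hz] := refl PHI.
have cz (f : dual N) : f (y n) @[n --> U] --> f z.
  have [M fM] := dual_bounded f.
  have fM' x : `|f x| <= (`|M| * K) * `|x|.
    apply: le_trans (fM x) _; apply: (@le_trans _ _ (`|M| * N x)).
      by rewrite ler_wpM2r ?is_norm_ge0// ler_norm.
    by rewrite -mulrA ler_wpM2l//; exact: (HK x).2.
  have [f' f'E] := lin_dual (dual_lin f) fM'.
  by have := cphi f'; rewrite -PHIE Hz f'E.
exists z; split => //.
have [->|/eqP z0] := eqVneq z 0; first by rewrite is_norm0.
have [h [hl hN hz]] := smooth_support N_norm (N_smooth z z0).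
have hN' x : `|h x| <= 1 * N x by rewrite mul1r; exact: lin_le_normr.
have [H HE] := lin_dual hl hN'.
have := cz H; rewrite HE hz => c.
apply: (ler_cvg_to c (cvg_cst _)).
by apply: nearW => n; apply: le_trans (hN _) (Ny n).
Qed.

(** * The constructed norm *)

Lemma open_dual_eval_gt0 (R : realType) (Z : lmodType R) (N : Z -> R) (w : Z) :
  open ([set h | 0 < h w] :
    set (initial_topology (fun f : dual N => (f : {ptws Z -> R})))).
Proof.
exists [set k : {ptws Z -> R} | 0 < k w] => //.
have -> : [set k : {ptws Z -> R} | 0 < k w] = proj w @^-1` [set t : R | 0 < t].
  by [].
apply: open_comp; last exact: open_gt.
by move=> k _; exact: proj_continuous.
Qed.

(** The vector [v = w - g 1 w *: e 1] is annihilated by every [g n]. If it were nonzero, a support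
    functional would be positive at [v], and w*-density would give an element of the span of [g]
    positive at [v]. *)
Lemma M_basis_total (R : realType) (X : completeNormedModType R) (T : X -> R)
    (e : nat -> X) (g : nat -> dual (@Num.norm R X)) (w : X) :
  equivalent_norm T -> (forall x, x <> 0 -> smooth_at T x) -> M_basis e g ->
  (forall n, (2 <= n)%N -> g n w = 0) -> w = g 1%N w *: e 1%N.
Proof.
move=> T_equiv T_smooth [ge _ gd] gw; pose v := w - g 1%N w *: e 1%N.
have gv n : (0 < n)%N -> g n v = 0.
  move=> n0; rewrite (linB (dual_lin (g n))) (linZ (dual_lin (g n))) ge//.
  have [->|n1] := eqVneq n 1%N; first by rewrite mulr1 subrr.
  by rewrite mulr0 subr0 gw// ltn_neqAle eq_sym n1.
suff v0 : v = 0 by apply/eqP; rewrite -subr_eq0 -/v v0.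
apply: contrapT => v0; have T_norm := proj1 T_equiv.
have [f [fl fT fv]] := smooth_support T_norm (T_smooth v v0).
have [K K0 HK] := norm_equiv_bound T_equiv.
have fK x : `|f x| <= K * `|x|.
  exact: le_trans (lin_le_normr fl T_norm fT x) (HK x).2.
have [F FE] := lin_dual fl fK.
have [|h [hv [n [a hE]]]] := gd _ _ (open_dual_eval_gt0 _ v).
  by exists F => /=; rewrite FE fv; exact: is_norm_gt0.
have : h v = 0.
  pose ev (k : dual (@Num.norm R X)) : R := k v.
  have evl : lin ev by [].
  rewrite hE -[LHS]/(ev _) (lin_sum evl) big_nat_cond big1//.
  by move=> k /andP[/andP[k0 _] _]; rewrite (linZ evl) /ev gv// mulr0.
by move=> hv0; have := (hv : 0 < h v); rewrite hv0 ltxx.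
Qed.

(** * The four properties of the constructed norm *)

Section construction.
Context {R : realType} {X : completeNormedModType R}.
Context {T : X -> R} {e : nat -> X} {g : nat -> dual (@Num.norm R X)}.
Hypothesis T_equiv : equivalent_norm T.
Hypothesis eg_basis : M_basis e g.
Hypothesis T_LUR : LUR T.
Hypothesis T_gateaux : gateaux_smooth T.
Hypothesis T_split :
  forall x, T x ^+ 2 = T (x - g 1%N x *: e 1%N) ^+ 2 + g 1%N x ^+ 2.
Hypothesis T_e : forall n, (0 < n)%N -> T (e n) = 1.

Let T_norm : is_norm T := proj1 T_equiv.
Let T_ge0 := is_norm_ge0 T_norm.

Let T_smooth x : x <> 0 -> smooth_at T x.
Proof. exact: gateaux_smooth_at. Qed.

Let g_lin n : lin (g n) := dual_lin (g n).

Let g_bounded n : exists M, forall x, `|g n x| <= M * T x.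
Proof.
have [M gM] := dual_bounded (g n); have [K K0 HK] := norm_equiv_bound T_equiv.
exists (`|M| * K) => x; apply: le_trans (gM x) _.
apply: (@le_trans _ _ (`|M| * `|x|)); first by rewrite ler_wpM2r// ler_norm.
by rewrite -mulrA ler_wpM2l//; exact: (HK x).1.
Qed.

Let g_le n x : `|g n x| <= dual_norm T (g n) * T x.
Proof. by have [M gM] := g_bounded n; exact: (le_dual_norm T_norm (g_lin n) gM). Qed.

Let g_e m n : (0 < m)%N -> (0 < n)%N -> g m (e n) = (m == n)%:R.
Proof. by case: eg_basis => H _ _; exact: H. Qed.

Let g_norm n : (0 < n)%N -> 1 <= dual_norm T (g n).
Proof.
move=> n0; have := g_le n (e n).
by rewrite g_e// eqxx normr1 T_e// mulr1.
Qed.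

Definition normalized (n : nat) (x : X) : R := g n x / dual_norm T (g n).
Let F := normalized.

Let F_lin n : lin (F n).
Proof. by move=> a x y; rewrite /F /normalized g_lin mulrDl mulrA. Qed.

Let F_le n x : (2 <= n)%N -> `|F n x| <= T x.
Proof.
move=> n2; have n1 := g_norm (ltnW n2).
have n0 : 0 < dual_norm T (g n) by apply: lt_le_trans n1.
by rewrite /F /normalized normrM normfV (gtr0_norm n0) ler_pdivrMr// mulrC g_le.
Qed.

Let F_total w : (forall n, (2 <= n)%N -> F n w = 0) -> w = g 1%N w *: e 1%N.
Proof.
move=> Fw; apply: M_basis_total T_equiv T_smooth eg_basis _ => n n2.
have n1 := g_norm (ltnW n2).
have := Fw n n2; rewrite /F /normalized => /eqP; rewrite mulf_eq0 invr_eq0.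
by move=> /orP[/eqP//|/eqP n0]; rewrite n0 ler10 in n1.
Qed.

Let e_dense : dense (lin_span e).
Proof. by case: eg_basis. Qed.

Let p := norm_D T e.
Let B := weighted_form F.
Let N := perturbed_norm p B.
Let p_norm : is_norm p := norm_D_is_norm T_equiv T_e.
Let B_lin : forall y, lin (B^~ y) := weighted_form_lin F_lin F_le.
Let B_sym : forall x y, B x y = B y x := @weighted_form_sym _ _ F.
Let B_ge0 : forall x, 0 <= B x x := weighted_form_ge0 F_le.
Let N_norm : is_norm N := perturbed_is_norm p_norm B_lin B_sym B_ge0.

Lemma constructed_normE : constructed_norm T e g = N.
Proof.
by apply/funext => x; congr (Num.sqrt (_ + limn _)).
Qed.

Let N_le_T x : N x <= 2 * T x.
Proof. exact: perturbed_norm_le_T. Qed.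

Let T_le_N x : T x <= 4 * N x.
Proof.
apply: le_trans (T_le_norm_D T_equiv T_e x) _; rewrite ler_wpM2l//.
exact: le_perturbed_norm.
Qed.

Let N_smooth x : x <> 0 -> smooth_at N x.
Proof.
move=> x0; apply: perturbed_smooth => //.
exact: norm_D_smooth.
Qed.

Let N_equiv : equivalent_norm N.
Proof.
split=> //; have [K K0 HK] := norm_equiv_bound T_equiv.
exists (4 * K)^-1, (2 * K); split; rewrite ?invr_gt0 ?mulr_gt0// => x.
have [H1 H2] := HK x.
apply/andP; split.
  rewrite ler_pdivrMl ?mulr_gt0//; apply: le_trans H1 _.
  by rewrite [4 * K]mulrC -mulrA ler_pM2l.
by apply: le_trans (N_le_T x) _; rewrite -mulrA ler_pM2l.
Qed.

Lemma constructed_gateaux : gateaux_smooth N.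
Proof.
apply: (smooth_at_gateaux N_norm) => x Nx; apply: N_smooth => x0.
by have := oner_eq0 R; rewrite -Nx x0 is_norm0// eqxx.
Qed.

Lemma constructed_ALUR : ALUR N.
Proof.
apply: separated_ALUR => // x Nx eps e0.
have x0 : x <> 0.
  by move=> x0; have := oner_eq0 R; rewrite -Nx x0 is_norm0// eqxx.
have g1_e k : (0 < k)%N -> g 1%N (e k) = (k == 1%N)%:R.
  by move=> k0; rewrite g_e// eq_sym.
have [psi [psil psip psix]] :=
  smooth_support p_norm (norm_D_smooth T_equiv T_e T_smooth e_dense x0).
exact: (slice_separated_all T_equiv T_e T_smooth T_LUR F_lin F_le (g_lin 1)
  g1_e T_split F_total Nx psil psip psix e0).
Qed.

Lemma constructed_frechet : reflexive_space (@Num.norm R X) ->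
  frechet_smooth (fun f : dual N => dual_norm N f).
Proof.
move=> refl; have [U [UP Uoo Ulim]] := ultrafilter_limits R.
apply: (ALUR_dual_frechet N_norm constructed_ALUR UP Uoo).
exact: (reflexive_weak_limit N_equiv N_smooth UP Ulim refl).
Qed.

Hypothesis g3n_norm : forall n, (0 < n)%N -> dual_norm T (g (3 * n)%N) = 1.

Let s2 : R := Num.sqrt 2.
Let s2_gt0 : 0 < s2. Proof. by rewrite sqrtr_gt0. Qed.
Let s2_sqr : s2 ^+ 2 = 2. Proof. exact: sqr_sqrtr. Qed.
Let s2_ge1 : 1 <= s2. Proof. by rewrite -[leLHS]sqrtr1 ler_wsqrtr// ler1n. Qed.

Let g1_le x : `|g 1%N x| <= T x.
Proof. exact: g1_le. Qed.

Let g_T_op n a b : (0 < n)%N -> l2le a b -> g n (T_op e a) = T_wt n * a n.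
Proof.
move=> n0 la; have n1 := g_norm n0.
apply: (T_op_coordinate T_equiv T_e (g_lin n) (g_le n) _ (l2le_bound la) n0).
  exact: le_trans n1.
by move=> k k0; rewrite g_e// eq_sym.
Qed.

Let x1 : X := s2 *: e 1%N.

Let p_x1 : p x1 = 1.
Proof.
apply/eqP; rewrite eq_le; apply/andP; split.
  have := norm_D_T_op T_equiv T_e (l2le_trunc (fun=> 1) 2).
  by rewrite (T_op_trunc T_equiv T_e) /T_part !big_nat1 /T_wt eqxx mulr1 expr1n sqrtr1.
(* The functional [g 1 / sqrt 2] is at most 1 on [D]; the zero summand only matches the form of
   [lin_comb]. *)
have H := lin_le_norm_D T_equiv T_e (f := fun x => s2^-1 * g 1%N x + 0 * g 1%N x) ler01.
have := H _ _ _ x1; rewrite (linZ (g_lin 1)) g_e// eqxx mulr1 mul0r addr0.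
rewrite mulVf ?gt_eqF// mul1r; apply.
- exact: lin_comb.
- move=> x; rewrite mul0r addr0 mul1r ler_pdivrMl//.
  apply: le_trans (ler_norm _) _; apply: le_trans (g1_le x) _.
  by rewrite ler_peMl.
- move=> a b la; rewrite mul0r addr0 mul1r (g_T_op _ la)// /T_wt eqxx -/s2.
  rewrite mulKf ?gt_eqF//; apply: le_trans (ler_norm _) _.
  exact: (l2le_bound la).
Qed.

Let N_x1 : N x1 = 1.
Proof.
have B0 : B x1 x1 = 0.
  apply/eqP; rewrite eq_le B_ge0 andbT.
  have F0 k : (2 <= k)%N -> F k x1 = 0.
    move=> k2; rewrite /F /normalized /x1 (linZ (g_lin k)) g_e ?(ltnW k2)//.
    by rewrite gtn_eqF// mulr0 mul0r.
  have := weighted_form_single F_le (isT : (2 <= 2)%N) (fun k k2 _ => F0 k k2).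
  by rewrite F0// expr0n mulr0.
by rewrite /N /perturbed_norm p_x1 B0 addr0 expr1n sqrtr1.
Qed.

(** The shift to [n.+1] makes the index a positive multiple of 3, hence larger than 1. *)
Let m n := (3 * n.+1)%N.
Let u n : X := s2^-1 *: (e 1%N + e (m n)).

(** By [T_split], [T (u n) ^+ 2] is [1/2 + 1/2]; the quadratic form sees only the coordinate [m n],
    with weight [2 ^- m n]. *)
Let N_u n : N (u n) ^+ 2 <= 1 + n.+1%:R^-1.
Proof.
have m1 : (1 < m n)%N by rewrite /m mulnS.
have m0 := ltnW m1.
have gm1 : g 1%N (u n) = s2^-1.
  by rewrite /u (linZ (g_lin 1)) (linD (g_lin 1)) !g_e// eqxx (ltn_eqF m1) addr0 mulr1.
have Tu : T (u n) <= 1.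
  rewrite -(ler_pXn2r (n := 2)) ?nnegrE// expr1n T_split gm1.
  have -> : u n - s2^-1 *: e 1%N = s2^-1 *: e (m n).
    by rewrite /u scalerDr addrAC subrr add0r.
  rewrite (is_normZ T_norm) T_e// mulr1 ger0_norm ?invr_ge0 ?(ltW s2_gt0)//.
  by rewrite exprVn s2_sqr; lra.
rewrite perturbed_norm_sqr//; apply: lerD.
  rewrite -[leRHS](expr1n _ 2) lerXn2r ?nnegrE ?(is_norm_ge0 p_norm)//.
  exact: le_trans (norm_D_le_T T_equiv T_e _) Tu.
have Fu k : (2 <= k)%N -> k != m n -> F k (u n) = 0.
  move=> k2 km; rewrite /F /normalized /u (linZ (g_lin k)) (linD (g_lin k)).
  by rewrite !g_e ?(ltnW k2)// (gtn_eqF k2) (negbTE km) addr0 mulr0 mul0r.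
apply: le_trans (weighted_form_single F_le m1 Fu) _.
apply: (@le_trans _ _ (2 ^- m n * 1)).
  rewrite ler_wpM2l ?invr_ge0 ?exprn_ge0//.
  rewrite -[leRHS](expr1n _ 2); apply: sqr_le_sqr;
    have := F_le (u n) m1; rewrite ler_norml => /andP[]; lra.
rewrite mulr1 lef_pV2 ?posrE ?exprn_gt0// -natrX ler_nat.
by apply: leq_trans (ltnW (ltn_expl _ _)); rewrite // /m leq_pmull.
Qed.

(** The functional [(g 1 + g (m n)) / sqrt 2] takes the value 2 at [x1 + u n]. On the [T]-ball it is
    at most 1 by [T_split], since [g (m n)] kills [e 1] and has dual norm 1; on the l2 image the
    second term adds at most [1/(n+1)]. *)
Let N_xu n : 2 <= (1 + n.+1%:R^-1) * N (x1 + u n).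
Proof.
have m1 : (1 < m n)%N by rewrite /m mulnS.
have m0 := ltnW m1.
have gm x : `|g (m n) x| <= T (x - g 1%N x *: e 1%N).
  have := g_le (m n) (x - g 1%N x *: e 1%N); rewrite /m g3n_norm// mul1r.
  rewrite -/(m n) (linB (g_lin _)) (linZ (g_lin _)) g_e// gtn_eqF// mulr0 subr0.
  by [].
have d0 : (0 : R) <= n.+1%:R^-1 by rewrite invr_ge0.
have d1 : 0 <= 1 + n.+1%:R^-1 :> R by rewrite addr_ge0.
have is2 : 0 <= s2^-1 by rewrite invr_ge0 ltW.
have H := lin_le_norm_D T_equiv T_e
  (f := fun x => s2^-1 * g 1%N x + s2^-1 * g (m n) x) d1.
have {}H : s2^-1 * g 1%N (x1 + u n) + s2^-1 * g (m n) (x1 + u n) <=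
    (1 + n.+1%:R^-1) * p (x1 + u n).
  apply: H.
  - exact: lin_comb.
  - move=> x; apply: (@le_trans _ _ (T x)); last by rewrite ler_peMl// lerDl.
    rewrite -mulrDr ler_pdivrMl//.
    have := T_split x; have := gm x; have := g1_le x.
    have := ler_norm (g 1%N x); have := ler_norm (g (m n) x).
    rewrite -(real_normK (num_real (g 1%N x))).
    set a := `|g 1%N x|; set b := `|g (m n) x|; set t := T (x - _).
    move=> h1 h2 h3 h4 h5; apply: (@le_trans _ _ (a + t)); first by lra.
    have t0 : 0 <= t by exact: T_ge0.
    have a0 : 0 <= a by exact: normr_ge0.
    rewrite -(ler_pXn2r (n := 2)) ?nnegrE ?addr_ge0 ?mulr_ge0 ?(ltW s2_gt0)//.
    rewrite exprMn s2_sqr h5; have := sqr_ge0 (a - t); nra.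
  - move=> a b la; have bd := l2le_bound la; have [b0 _] := la.
    rewrite !(g_T_op _ la)// {1}/T_wt eqxx -/s2 mulKf ?gt_eqF//.
    rewrite mulrDl mul1r; apply: lerD.
      by apply: le_trans (ler_norm _) _; exact: bd.
    rewrite mulrA; apply: le_trans (ler_norm _) _; rewrite normrM.
    apply: ler_pM => //; last exact: bd.
    rewrite ger0_norm ?mulr_ge0 ?(ltW (T_wt_gt0 m0))//.
    rewrite /T_wt gtn_eqF//.
    apply: (@le_trans _ _ (1 * (((m n)%:R : R) ^+ 2)^-1)).
      by rewrite ler_wpM2r ?invr_ge0 ?sqr_ge0// invf_le1.
    rewrite mul1r lef_pV2 ?posrE ?exprn_gt0 ?ltr0n// -natrX ler_nat.
    apply: (@leq_trans (m n)); first by rewrite /m leq_pmull.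
    by rewrite -{1}(expn1 (m n)) leq_pexp2l.
apply: le_trans (le_trans H _); last first.
  by rewrite ler_wpM2l// le_perturbed_norm.
rewrite !(linD (g_lin _)) /x1 /u !(linZ (g_lin _)) !(linD (g_lin _)) !g_e//.
rewrite !eqxx (ltn_eqF m1) (gtn_eqF m1) !addr0 !add0r !mulr1 mulr0 add0r.
have -> : s2^-1 * (s2 + s2^-1) + s2^-1 * s2^-1 = 1 + 2 * (s2 ^+ 2)^-1.
  by field; rewrite gt_eqF.
by rewrite s2_sqr; lra.
Qed.

Lemma constructed_not_LUR : ~ LUR N.
Proof.
move=> NL; have : N (u n - x1) @[n --> \oo] --> 0.
  apply: (NL x1 N_x1); rewrite N_x1.
  (* With [d = 1/(n+1)], the expression is at most [2 + 2 (1 + d) - 4 (1 - d)^2 <= 10 d]. *)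
  have c0 : (10 * n.+1%:R^-1) @[n --> \oo] --> (0 : R).
    rewrite -(mulr0 (10 : R)); apply: cvgM; first exact: cvg_cst.
    exact: cvg_harmonic.
  apply: squeeze_cvgr (cvg_cst 0) c0; apply: nearW => n.
  have h1 := N_u n; have h2 := N_xu n.
  have h3 := is_normD N_norm x1 (u n); rewrite N_x1 in h3.
  have d0 : (0 : R) < n.+1%:R^-1 by rewrite invr_gt0.
  have d1 : (n.+1%:R^-1 : R) <= 1 by rewrite invf_le1// ler1n.
  have T0 := is_norm_ge0 N_norm (u n); have T1 := is_norm_ge0 N_norm (x1 + u n).
  set d := n.+1%:R^-1 in h1 h2 d0 d1 *.
  set y := N (u n) in h1 h3 T0 *; set z := N (x1 + u n) in h2 h3 T1 *.
  apply/andP; split; first by have := sqr_ge0 (y - 1); nra.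
  have h4 : 2 * (1 - d) <= z.
    apply: le_trans (_ : 2 * (1 - d) <= (1 - d) * ((1 + d) * z)) _.
      by rewrite mulrC ler_wpM2l//; lra.
    by rewrite mulrA; nra.
  have h5 : 4 * (1 - d) ^+ 2 <= z ^+ 2.
    have -> : 4 * (1 - d) ^+ 2 = (2 * (1 - d)) ^+ 2 by ring.
    by apply: sqr_le_sqr; lra.
  nra.
(* The functional [g 1] separates [u n] from [x1] by [sqrt 2 - 1 / sqrt 2 = 1 / sqrt 2]; the factor
   4 comes from [T_le_N]. *)
have c : 0 < (4 * s2)^-1 by rewrite invr_gt0 mulr_gt0.
move=> /cvgrPdist_lt /(_ _ c) [n _ /(_ n (leqnn n))] /=.
rewrite sub0r normrN ger0_norm ?(is_norm_ge0 N_norm)// ltNge => /negP; apply.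
have m1 : (1 < m n)%N by rewrite /m mulnS.
have : s2^-1 <= T (u n - x1).
  apply: le_trans (g1_le _).
  rewrite (linB (g_lin 1)) /u /x1 !(linZ (g_lin 1)) (linD (g_lin 1)).
  rewrite !g_e ?(ltnW m1)// eqxx (ltn_eqF m1) addr0 !mulr1 distrC.
  have -> : s2 - s2^-1 = s2^-1 by rewrite -[X in X - _](mulfK (lt0r_neq0 s2_gt0)) -expr2 s2_sqr; lra.
  exact: ler_norm.
have := T_le_N (u n - x1); rewrite invfM; lra.
Qed.

End construction.

Unset Implicit Arguments.

Theorem theorem3p8 (R : realType) (X : completeNormedModType R)
    (trinorm : X -> R) (e : nat -> X) (g : nat -> dual (@Num.norm R X))
    (X_inf : infinite_dimensional X)
    (X_sep : separable X)
    (trinorm_equiv : equivalent_norm trinorm)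
    (eg_basis : M_basis e g)
    (trinorm_LUR : LUR trinorm)
    (trinorm_gateaux : gateaux_smooth trinorm)
    (trinorm_split : forall x : X,
      trinorm x ^+ 2 = trinorm (x - g 1%N x *: e 1%N) ^+ 2 + g 1%N x ^+ 2)
    (trinorm_e : forall n : nat, (0 < n)%N -> trinorm (e n) = 1)
    (trinorm_g1 : dual_norm trinorm (g 1%N) = 1)
    (trinorm_g3n : forall n : nat, (0 < n)%N -> dual_norm trinorm (g (3 * n)%N) = 1) :
  let N := constructed_norm trinorm e g in
  [/\ gateaux_smooth N,
      ALUR N,
      reflexive_space (@Num.norm R X) ->
        frechet_smooth (fun f : dual N => dual_norm N f)
    & ~ LUR N].
Proof.
rewrite constructed_normE.
split.
- exact: (constructed_gateaux trinorm_equiv eg_basis trinorm_gateaux trinorm_e).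
- exact: (constructed_ALUR trinorm_equiv eg_basis trinorm_LUR trinorm_gateaux
    trinorm_split trinorm_e).
- exact: (constructed_frechet trinorm_equiv eg_basis trinorm_LUR trinorm_gateaux
    trinorm_split trinorm_e).
- exact: (constructed_not_LUR trinorm_equiv eg_basis trinorm_split trinorm_e
    trinorm_g3n).
Qed.
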